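(* Let $n\ge 1$ and let $\Delta=\operatorname{conv}(v_0,\dots,v_n)\subset\mathbb{R}^n$ be an integral $\mathbb{Z}^n$-simplex with weight $Q(\Delta)=(q_0,\dots,q_n)$, and put $\mu_\Delta:=n!\operatorname{vol}(\Delta)$. Assume that $\Delta$ is reduced. Let $$F:=\left\{\tfrac{\ell}{q_i}\ \middle|\ 0\le \ell\le q_i-1,\ 0\le i\le n\right\},$$ let $f_1<f_2<\cdots<f_k$ be the elements of the set $F$ arranged in increasing order, let $d_i:=\operatorname{Card}\{j\in\{0,\dots,n\}\mid q_jf_i\in\mathbb{Z}\}$ for $i=1,\dots,k$, and let $c_0,c_1,\dots,c_{\mu_\Delta-1}$ be the sequence $$\underbrace{f_1,\dots,f_1}_{d_1},\underbrace{f_2,\dots,f_2}_{d_2},\dots,\underbrace{f_k,\dots,f_k}_{d_k}.$$ Then the Newton spectrum of $\Delta$ is $$\operatorname{Spec}_\Delta(z)=z^{\alpha_0}+z^{\alpha_1}+\cdots+z^{\alpha_{\mu_\Delta-1}},\qquad\text{where } \alpha_j:=j-\mu_\Delta c_j \text{ for } j=0,\dots,\mu_\Delta-1.$$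
   Context: An integral $\mathbb{Z}^n$-simplex is a polytope $\Delta=\operatorname{conv}(v_0,\dots,v_n)\subset\mathbb{R}^n$ whose vertices $v_0,\dots,v_n$ belong to $\mathbb{Z}^n$ and which contains the origin as an interior point. Its weight is the tuple $Q(\Delta)=(q_0,\dots,q_n)$ with $q_i:=|\det(v_0,\dots,\widehat{v_i},\dots,v_n)|$ (the vector $v_i$ is omitted). The simplex $\Delta$ is called reduced if $\gcd(q_0,\dots,q_n)=1$. The volume $\operatorname{vol}$ is normalized so that the unit cube has volume $1$; one has $\mu_\Delta=\sum_{i=0}^n q_i=\sum_{i=1}^k d_i$. The Newton function $\nu:\mathbb{R}^n\to\mathbb{R}$ of $\Delta$ is the function taking the value $1$ at each vertex of $\Delta$ and linear on each cone over a proper face of $\Delta$. The Newton spectrum of $\Delta$ is $$\operatorname{Spec}_\Delta(z):=(1-z)^n\sum_{v\in\mathbb{Z}^n}z^{\nu(v)},$$ a formal series in $z$ with nonnegative rational exponents (that is, an element of $\mathbb{Z}[[z^{1/d}]]$ for a suitable integer $d\ge1$ such that $d\,\nu$ is integer-valued on $\mathbb{Z}^n$). *)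

(* Defs.v *)
From mathcomp Require Import all_boot all_order all_algebra.
From mathcomp Require Import all_classical all_reals all_analysis.

Set Implicit Arguments.
Unset Strict Implicit.
Unset Printing Implicit Defensive.

Import Order.TTheory GRing.Theory Num.Theory.
Import numFieldNormedType.Exports.

Local Open Scope classical_set_scope.
Local Open Scope ring_scope.

Section Volume.
Variable R : realType.

(* The n-fold product of the Lebesgue measure of R.  As for the library's
   product measure of two factors (product_measure1), the measure of A is the
   integral of the measures of its sections.  It is only a set function, so
   that 'rV[R]_n needs no measurable structure. *)
Fixpoint lebesgue_volume (n : nat) : set 'rV[R]_n -> \bar R :=
  match n return set 'rV[R]_n -> \bar R with
  | 0 => fun A => (\1_A 0)%:E
  | m.+1 => fun A : set 'rV[R]_(1 + m) =>
      (\int[@lebesgue_measure R]_x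
         lebesgue_volume [set y : 'rV[R]_m | A (row_mx x%:M y)])%E
  end.

End Volume.

Section FormalSeries.
Variable R : realType.

(* Formal series in z with integer coefficients and real exponents, as
   coefficient functions; Z[[z^{1/d}]] is the subset of those series supported
   on (1/d)N.  The sums below range over infinite types: \sum_(_ \in setT) adds
   the nonzero terms when they are finitely many (and is 0 otherwise). *)
Definition fseries := R -> int.

Definition fs_monomial (a : R) : fseries := fun e => (e == a)%:R.

Definition fs_mul (s t : fseries) : fseries :=
  fun e => \sum_(a \in [set: R]) s a * t (e - a).

Definition fs_exp (s : fseries) (n : nat) : fseries :=
  iter n (fs_mul s) (fs_monomial 0).

End FormalSeries.

Section Simplex.
Variables (R : realType) (n : nat).
(* The vertices of the simplex are the rows of v. *)
Variable v : 'M[int]_(n.+1, n).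

Definition vertex (i : 'I_n.+1) : 'rV[R]_n := map_mx intr (row i v).

Definition simplex : set 'rV[R]_n :=
  [set x | exists t : 'I_n.+1 -> R,
     [/\ forall i, 0 <= t i, \sum_i t i = 1 & x = \sum_i t i *: vertex i]].

(* The vertices are then affinely independent, since the interior of their
   convex hull is not empty. *)
Definition integral_simplex : Prop := (simplex)° 0.

Definition weight (i : 'I_n.+1) : nat := `|\det (row' i v)|%N.

Definition reduced : Prop := \big[gcdn/0%N]_(i < n.+1) weight i = 1%N.

(* The cone over the face conv {v_i | i in I}. *)
Definition face_cone (I : {set 'I_n.+1}) : set 'rV[R]_n :=
  [set x | exists2 t : 'I_n.+1 -> R,
     forall i, 0 <= t i & x = \sum_(i in I) t i *: vertex i].

(* The proper faces of a simplex are the convex hulls of the proper subsets of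
   its set of vertices. *)
Definition is_newton_function (nu : 'rV[R]_n -> R) : Prop :=
  (forall i, nu (vertex i) = 1) /\
  (forall I : {set 'I_n.+1}, I \proper 'I_n.+1 ->
     exists L : {scalar 'rV[R]_n}, {in face_cone I, nu =1 L}).

Definition newton_function : 'rV[R]_n -> R :=
  get [set nu | is_newton_function nu].

Definition newton_spectrum : fseries R :=
  fs_mul (fs_exp (fs_monomial 0 \- fs_monomial 1) n)
    (fun e => \sum_(w \in [set: 'rV[int]_n])
                fs_monomial (newton_function (map_mx intr w)) e).

(* mu_Delta = n! vol(Delta) *)
Definition simplex_mu : R := n`!%:R * fine (lebesgue_volume simplex).

(* f_1 < ... < f_k *)
Definition fractions : seq rat :=
  sort <=%R (undup
    [seq (l%:R / (weight i)%:R : rat) | i <- enum 'I_n.+1, l <- iota 0 (weight i)]).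

(* d_i, as a function of f_i *)
Definition fraction_mult (f : rat) : nat :=
  #|[pred j : 'I_n.+1 | (weight j)%:R * f \is a Num.int]|.

(* c_0, c_1, ... *)
Definition fraction_seq : seq rat :=
  flatten [seq nseq (fraction_mult f) f | f <- fractions].

Definition alpha (j : nat) : R := j%:R - simplex_mu * ratr fraction_seq`_j.

End Simplex.

Arguments newton_function R {n} v _.
Arguments newton_spectrum R {n} v _.
Arguments alpha R {n} v j.
Arguments simplex_mu R {n} v.
Arguments simplex R {n} v _.
Arguments vertex R {n} v i.
Arguments integral_simplex R {n} v.

(* Main.v *)
Require Import Defs.
From HB Require Import structures.
From mathcomp Require Import all_boot all_order all_algebra.
From mathcomp Require Import all_classical all_reals all_analysis.
From mathcomp Require Import measurable_realfun.
From mathcomp Require Import ring zify.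
Import Order.TTheory GRing.Theory Num.Theory.
Import numFieldNormedType.Exports.
Local Open Scope classical_set_scope.
Local Open Scope ring_scope.

(** Write q_i for the weights of the simplex and M for their sum.

    Both claims rest on the relation sum_i q_i v_i = 0 between the vertices.
    The signed maximal minors of v form a relation, being the first row of the
    adjugate of the square matrix (1 | v).  As the origin is interior, there is
    also a relation with positive coefficients; the two are proportional, so
    the minors have one sign and M is the absolute value of det (1 | v).

    Volume.  An affine map carries the standard simplex onto the given one, and
    its determinant is det (1 | v), so M = n! vol as soon as the iterated
    Lebesgue integral transforms by the determinant
    ([change_of_variablesP]) and the standard simplex has volume 1/n!
    ([volume_standard_simplex]).  The change of variables is Gaussian
    elimination: a matrix with nonzero pivot is a product of a lower shear, a
    block diagonal matrix and an upper shear.  An upper shear translates each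
    section; a lower shear becomes one after Tonelli's theorem moves the first
    integration innermost.

    Spectrum.  If the gcd of the weights is 1, the vertices generate Z^n and
    their integral relations are the multiples of q.  Hence
    a |-> sum_i a_i v_i is a bijection onto Z^n from the families a of naturals
    that do not satisfy a >= q ([lattice_point_bij]), and the Newton function
    takes at that point the value |a| - M min_i (a_i / q_i), where |a| is the
    sum of the a_i ([newton_lattice_point]).

    Order the pairs (i, l) with l < q_i by the fraction l / q_i.  Adding one
    unit vector e_i for each pair (i, l) in turn gives a staircase
    0 = b_0 <= b_1 <= ... <= b_M = q, so the families that are not above q are
    partitioned according to the last b_j that they dominate.  In the j-th
    piece, a - b_j is any family with a zero at the index i_j of the j-th step,
    and the minimum of a_i / q_i is exactly c_j ([chain_ge], [chain_step]).
    The j-th piece thus contributes z^(j - M c_j) / (1 - z)^n, and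
    multiplication by (1 - z)^n, which is n-fold backward difference of the
    coefficient function, leaves z^(alpha_j). *)

Set Implicit Arguments.
Unset Strict Implicit.
Unset Printing Implicit Defensive.

(** * The Lebesgue integral under an affine change of variable *)

Section LinearIntegral.
Variable R : realType.
Local Notation mu := (@lebesgue_measure R).

(** Lebesgue measure is determined by its values on half-open intervals, and
    the preimage of such an interval under the map is one of length divided
    by a. *)
Lemma ge0_integral_lebesgue_affine (f : R -> \bar R) (a b : R) : 0 < a ->
  measurable_fun [set: R] f -> (forall x, (0 <= f x)%E) ->
  (a%:E * \int[mu]_x f (a * x + b)%R = \int[mu]_x f x)%E.
Proof.
move=> a0 mf f0.
pose phi (x : measurableTypeR R) : measurableTypeR R := a * x + b.
have mphi : measurable_fun setT phi.
  by apply: measurable_funD => //; apply: measurable_funM.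
have pE (x : R) : phi x = a * x + b by [].
have := @ge0_integral_pushforward _ _ _ _ R phi mphi mu setT f measurableT mf.
rewrite preimage_setT => <- //.
rewrite -(@ge0_integral_mscale _ _ _ (pushforward mu phi) _ measurableT
  (NngNum (ltW a0)))//.
apply: eq_measure_integral => A mA _.
apply/esym.
apply: lebesgue_measure_unique => // _ [[c d]] _ <-.
rewrite /= /mscale /= /pushforward.
have -> : phi @^-1` `]c, d] = `](c - b) / a, (d - b) / a]%classic.
  apply/seteqP; split => x /=; rewrite !in_itv/= ltr_pdivrMr// ler_pdivlMr// pE;
    by rewrite ltrBlDr lerBrDr mulrC.
rewrite !lebesgue_measure_itv /= !lte_fin ltr_pM2r ?invr_gt0// ltrD2r.
case: ifP => // _; rewrite ?mule0// -EFinM; congr (_%:E).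
by field; rewrite gt_eqF.
Qed.

Lemma ge0_integral_lebesgue_linear (f : R -> \bar R) (a b : R) : a != 0 ->
  measurable_fun [set: R] f -> (forall x, (0 <= f x)%E) ->
  (`|a|%:E * \int[mu]_x f (a * x + b)%R = \int[mu]_x f x)%E.
Proof.
move=> a0 mf f0; have [{}a0|a0'] := ltP 0 a.
  by rewrite gtr0_norm// ge0_integral_lebesgue_affine.
have {a0'}a0 : a < 0 by rewrite lt_neqAle a0.
rewrite ltr0_norm// -[RHS](@ge0_integral_lebesgue_affine f (- a) b) ?oppr_gt0//.
congr (_ * _)%E.
have mN : measurable_fun [set: measurableTypeR R]
  (-%R : measurableTypeR R -> measurableTypeR R) by [].
have mg : measurable_fun [set: R] (fun x : R => f (- a * x + b)).
  have mh : measurable_fun [set: R] (fun x : R => - a * x + b).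
    by apply: measurable_funD => //; apply: measurable_funM.
  exact: (measurableT_comp mf mh).
transitivity (\int[mu]_x ((fun x : R => f (- a * x + b)%R) \o -%R%R) x)%E.
  by apply: eq_integral => x _ /=; rewrite mulrNN.
have := @ge0_integral_pushforward _ _ _ _ R _ mN mu setT _ measurableT mg.
rewrite preimage_setT => <- //.
by apply: eq_measure_integral => A mA _; exact: lebesgue_measureN.
Qed.

End LinearIntegral.

(** * Iterated integrals *)

Section IteratedIntegral.
Variable R : realType.
Local Notation mu := (@lebesgue_measure R).

(** The functional whose value at the indicator of a set is its
    [lebesgue_volume].  Functions are needed to move an
    integration past the others: a section of an indicator, once integrated,
    is no longer one. *)
Fixpoint iterated_integral (n : nat) : ('rV[R]_n -> \bar R) -> \bar R :=
  match n with
  | 0 => fun f => f 0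
  | m.+1 => fun f : 'rV[R]_(1 + m) -> \bar R =>
      (\int[mu]_x iterated_integral (fun y => f (row_mx x%:M y)))%E
  end.

Lemma iterated_integralS m (f : 'rV[R]_(1 + m) -> \bar R) :
  iterated_integral (n := m.+1) f =
  (\int[mu]_x iterated_integral (fun y => f (row_mx x%:M y)))%E.
Proof. by []. Qed.

Lemma lebesgue_volumeE n (A : set 'rV[R]_n) :
  lebesgue_volume A = iterated_integral (fun x => (\1_A x)%:E).
Proof.
elim: n A => [//|m IH] A /=.
by apply: eq_integral => x _; rewrite IH.
Qed.

Definition measurable_coord d (U : measurableType d) n (y : U -> 'rV[R]_n) :=
  forall j, measurable_fun [set: U] (fun u => y u 0 j).

(** Measurability is tested by composition with families of points that are
    measurable in each coordinate, in place of a sigma-algebra on row vectors.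
    Sections and affine substitutions then preserve it by mere composition. *)
Definition jointly_measurable d (T : measurableType d) n
    (f : T -> 'rV[R]_n -> \bar R) :=
  forall d' (U : measurableType d') (t : U -> T) (y : U -> 'rV[R]_n),
  measurable_fun [set: U] t -> measurable_coord y ->
  measurable_fun [set: U] (fun u => f (t u) (y u)).

Definition borel_fun n (f : 'rV[R]_n -> \bar R) :=
  forall d (U : measurableType d) (y : U -> 'rV[R]_n),
  measurable_coord y -> measurable_fun [set: U] (fun u => f (y u)).

Lemma measurable_coord_row_mx d (U : measurableType d) m
    (x : U -> R) (y : U -> 'rV[R]_m) :
  measurable_fun [set: U] x -> measurable_coord y ->
  measurable_coord (fun u => row_mx (x u)%:M (y u) : 'rV[R]_(1 + m)).
Proof.
move=> mx my j; rewrite -(splitK j); case: (fintype.split j) => k /=.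
  under eq_fun do rewrite row_mxEl mxE (ord1 k) eqxx mulr1n.
  exact: mx.
under eq_fun do rewrite row_mxEr.
exact: my.
Qed.

Lemma measurable_coord_affine d (U : measurableType d) m n
    (y : U -> 'rV[R]_m) (G : 'M[R]_(m, n)) (c : 'rV[R]_n) :
  measurable_coord y -> measurable_coord (fun u => y u *m G + c).
Proof.
move=> my j; under eq_fun do rewrite !mxE.
apply: measurable_funD => //; apply: measurable_sum => i.
by apply: measurable_funM => //; exact: my.
Qed.

Lemma borel_fun_affine m n (f : 'rV[R]_n -> \bar R) (G : 'M[R]_(m, n)) c :
  borel_fun f -> borel_fun (fun x => f (x *m G + c)).
Proof. by move=> mf d U y my; apply: mf; exact: measurable_coord_affine. Qed.

Lemma jointly_measurable_row_mx m (f : 'rV[R]_(1 + m) -> \bar R) :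
  borel_fun f ->
  @jointly_measurable _ (measurableTypeR R) m (fun x y => f (row_mx x%:M y)).
Proof.
by move=> mf d U t y mt my; apply: mf; exact: measurable_coord_row_mx.
Qed.

Lemma jointly_measurable_fix d (T : measurableType d) n
    (f : T -> 'rV[R]_n -> \bar R) t : jointly_measurable f -> borel_fun (f t).
Proof. by move=> mf d' U y my; exact: (mf _ _ (fun=> t)). Qed.

Lemma borel_fun_row_mx m (f : 'rV[R]_(1 + m) -> \bar R) x :
  borel_fun f -> borel_fun (fun y => f (row_mx x%:M y)).
Proof.
by move=> /jointly_measurable_row_mx /(@jointly_measurable_fix _ _ _ _ x).
Qed.

Lemma iterated_integral_ge0 n (f : 'rV[R]_n -> \bar R) :
  (forall x, 0 <= f x)%E -> (0 <= iterated_integral f)%E.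
Proof.
elim: n f => [|m IH] f f0; first exact: f0.
rewrite iterated_integralS.
by apply: integral_ge0 => x _; exact: IH.
Qed.

(** The parameter space is arbitrary so that, in the induction, it can absorb
    the first coordinate. *)
Lemma measurable_iterated_integral d (T : measurableType d) n
    (f : T -> 'rV[R]_n -> \bar R) :
  jointly_measurable f -> (forall t x, 0 <= f t x)%E ->
  measurable_fun [set: T] (fun t => iterated_integral (f t)).
Proof.
elim: n d T f => [|m IH] d T f mf f0.
  by apply: (mf _ _ id (fun=> 0)) => // j; exact: measurable_cst.
pose g (p : T * measurableTypeR R) := iterated_integral
  (fun y : 'rV[R]_m => f p.1 (row_mx (p.2 : R)%:M y : 'rV[R]_(1 + m))).
have mg : measurable_fun [set: T * measurableTypeR R] g.
  apply: IH => // d' U t y mt my; apply: (mf _ _ (fun u => (t u).1)).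
    exact: measurableT_comp.
  apply: (@measurable_coord_row_mx _ _ _ (fun u => (t u).2)) => //.
  exact: measurableT_comp.
apply: (@measurable_fun_fubini_tonelli_F _ _ _ _ R mu _ mg).
by move=> p; exact: iterated_integral_ge0.
Qed.

(** Moving one integration past m others is m applications of the two-variable
    theorem. *)
Lemma iterated_integral_tonelli m (f : R -> 'rV[R]_m -> \bar R) :
  @jointly_measurable _ (measurableTypeR R) m f -> (forall x y, 0 <= f x y)%E ->
  (\int[mu]_x iterated_integral (f x) =
   iterated_integral (fun y => \int[mu]_x f x y))%E.
Proof.
elim: m f => [//|m IH] f mf f0.
rewrite iterated_integralS.
pose g (p : measurableTypeR R * measurableTypeR R) := iterated_integral
  (fun y : 'rV[R]_m => f p.1 (row_mx (p.2 : R)%:M y : 'rV[R]_(1 + m))).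
have mg : measurable_fun setT g.
  apply: measurable_iterated_integral => // d' U t y mt my.
  apply: (mf _ _ (fun u => (t u).1)); first exact: measurableT_comp.
  apply: (@measurable_coord_row_mx _ _ _ (fun u => (t u).2)) => //.
  exact: measurableT_comp.
have g0 p : (0 <= g p)%E by exact: iterated_integral_ge0.
rewrite [LHS](@fubini_tonelli _ _ _ _ R mu mu g mg g0).
apply: eq_integral => z _; apply: IH => // d U t y mt my.
by apply: mf => //; exact: measurable_coord_row_mx.
Qed.

Lemma iterated_integral_shift n (f : 'rV[R]_n -> \bar R) c :
  borel_fun f -> (forall x, 0 <= f x)%E ->
  iterated_integral (fun x => f (x + c)) = iterated_integral f.
Proof.
elim: n f c => [|m IH] f c mf f0 /=; first by rewrite [_ + c]thinmx0.
rewrite -[c in LHS](@hsubmxK _ 1 1 m) [X in row_mx X _]mx11_scalar.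
set c0 := lsubmx _ _ _; set c' := rsubmx _.
transitivity (\int[mu]_x iterated_integral
    (fun y => f (row_mx (1 * x + c0)%:M y : 'rV[R]_(1 + m))))%E.
  apply: eq_integral => x _; rewrite -[RHS](IH _ c') //.
    congr iterated_integral; apply: funext => y.
    by rewrite (@add_row_mx _ 1 1 m) -raddfD mul1r.
  exact: borel_fun_row_mx.
rewrite -(@ge0_integral_lebesgue_affine R
  (fun x => iterated_integral (fun y => f (row_mx x%:M y : 'rV[R]_(1 + m)))) 1 c0)//.
- by rewrite mul1e.
- apply: measurable_iterated_integral => //.
  exact: jointly_measurable_row_mx.
- by move=> x; exact: iterated_integral_ge0.
Qed.

Lemma iterated_integralZ n (f : 'rV[R]_n -> \bar R) (k : R) : 0 <= k ->
  borel_fun f -> (forall x, 0 <= f x)%E ->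
  iterated_integral (fun x => k%:E * f x)%E = (k%:E * iterated_integral f)%E.
Proof.
move=> k0; elim: n f => [//|m IH] f mf f0.
rewrite !iterated_integralS -ge0_integralZl//.
- by apply: eq_integral => x _; apply: IH => //; exact: borel_fun_row_mx.
- by apply: measurable_iterated_integral => //; exact: jointly_measurable_row_mx.
- by move=> x _; exact: iterated_integral_ge0.
Qed.

End IteratedIntegral.

(** * Linear changes of variables *)

Section ChangeOfVariables.
Variable R : realType.
Local Notation mu := (@lebesgue_measure R).
Local Notation iterated_integral := (@iterated_integral R).

Definition change_of_variables n (G : 'M[R]_n) :=
  forall f : 'rV[R]_n -> \bar R, borel_fun f -> (forall x, 0 <= f x)%E ->
  (`|\det G|%:E * iterated_integral (fun x => f (x *m G)) =
   iterated_integral f)%E.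

Lemma borel_fun_mul m n (f : 'rV[R]_n -> \bar R) (G : 'M[R]_(m, n)) :
  borel_fun f -> borel_fun (fun x => f (x *m G)).
Proof.
move=> mf; under eq_fun do rewrite -[_ *m G]addr0.
exact: borel_fun_affine.
Qed.

Lemma change_of_variables_mul n (A B : 'M[R]_n) :
  change_of_variables A -> change_of_variables B ->
  change_of_variables (A *m B).
Proof.
move=> cA cB f mf f0; rewrite -[RHS]cB// -(cA (fun x => f (x *m B)))//.
  rewrite muleA -EFinM det_mulmx normrM mulrC.
  by under eq_fun do rewrite mulmxA.
exact: borel_fun_mul.
Qed.

(** The section at x of a function composed with the shear is the section at x
    composed with a translation. *)
Lemma change_of_variables_ushear m (r : 'M[R]_(1, m)) :
  change_of_variables (block_mx 1%:M r 0 1%:M : 'M[R]_(1 + m)).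
Proof.
move=> f mf f0; rewrite det_ublock !det1 mulr1 normr1 mul1e.
rewrite !iterated_integralS; apply: eq_integral => x _.
rewrite -[RHS](iterated_integral_shift (x *: r))//; last exact: borel_fun_row_mx.
congr iterated_integral; apply: funext => y.
by rewrite mul_row_block !mulmx1 mulmx0 addr0 mul_scalar_mx addrC.
Qed.

(** The first coordinate is translated by a quantity that depends on the others
    only, so it has to be integrated first. *)
Lemma change_of_variables_lshear m (c : 'M[R]_(m, 1)) :
  change_of_variables (block_mx 1%:M 0 c 1%:M : 'M[R]_(1 + m)).
Proof.
move=> f mf f0; rewrite det_lblock !det1 mulr1 normr1 mul1e.
rewrite !iterated_integralS.
have mf' := jointly_measurable_row_mx mf.
have mg := jointly_measurable_row_mx
  (borel_fun_mul (block_mx 1%:M 0 c 1%:M : 'M[R]_(1 + m)) mf).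
rewrite !iterated_integral_tonelli//.
congr iterated_integral; apply: funext => y.
rewrite -[RHS](@ge0_integral_lebesgue_affine R _ 1 ((y *m c) 0 0)) ?mul1e//.
  apply: eq_integral => x _.
  rewrite mul_row_block !mulmx1 mulmx0 add0r mul1r.
  by rewrite [y *m c in LHS]mx11_scalar -raddfD.
by apply: mf' => // j; exact: measurable_cst.
Qed.

Lemma change_of_variables_diag m (g : R) (B : 'M[R]_m) : g != 0 ->
  change_of_variables B ->
  change_of_variables (block_mx g%:M 0 0 B : 'M[R]_(1 + m)).
Proof.
move=> g0 cB f mf f0; rewrite det_ublock det_scalar1 normrM.
rewrite !iterated_integralS.
pose F x := iterated_integral (fun y => f (row_mx x%:M y : 'rV[R]_(1 + m))).
have mF : measurable_fun [set: R] F.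
  by apply: measurable_iterated_integral => //; exact: jointly_measurable_row_mx.
have F0 x : (0 <= F x)%E by exact: iterated_integral_ge0.
rewrite -[RHS](@ge0_integral_lebesgue_linear R F g 0)//.
rewrite EFinM -muleA; congr (_ * _)%E.
rewrite -ge0_integralZl//; first last.
- by move=> x _; exact: iterated_integral_ge0.
- apply: measurable_iterated_integral => //.
  exact: (jointly_measurable_row_mx
    (borel_fun_mul (block_mx g%:M 0 0 B : 'M[R]_(1 + m)) mf)).
apply: eq_integral => x _.
rewrite /F -[RHS]cB//; last exact: borel_fun_row_mx.
congr (_ * iterated_integral _)%E; apply: funext => y.
by rewrite mul_row_block !mulmx0 addr0 add0r addr0 -scalar_mxM mulrC.
Qed.

(** The factorization of G into a lower shear, the diagonal of the pivot and
    its Schur complement, and an upper shear. *)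
Lemma change_of_variables_pivot m (G : 'M[R]_(1 + m)) :
  (forall B : 'M[R]_m, \det B != 0 -> change_of_variables B) ->
  \det G != 0 -> G 0 0 != 0 -> change_of_variables G.
Proof.
move=> IH dG.
pose a : 'M[R]_1 := ulsubmx G; pose r := ursubmx G; pose c := dlsubmx G.
pose B := drsubmx G; pose g := a 0 0.
have -> : G 0 0 = g by rewrite /g /a !mxE; congr (G _ _); exact: val_inj.
move=> g0.
have defG : G = (block_mx 1%:M 0 (g^-1 *: c) 1%:M : 'M[R]_(1 + m)) *m
   (block_mx g%:M 0 0 (B - g^-1 *: (c *m r)) *m
    block_mx 1%:M (g^-1 *: r) 0 1%:M).
  rewrite !mulmx_block !(mulmx0, mul0mx, mulmx1, mul1mx, addr0, add0r).
  rewrite !mul_scalar_mx !mul_mx_scalar !scalerA divff// !scale1r.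
  rewrite -scalemxAl -mx11_scalar addrC subrK.
  by rewrite -[LHS]submxK.
have dB : \det (B - g^-1 *: (c *m r)) != 0.
  apply: contra_neq dG => dB0.
  by rewrite defG !det_mulmx det_lblock !det_ublock dB0 !(mulr0, mul0r).
rewrite defG; apply: change_of_variables_mul.
  exact: change_of_variables_lshear.
apply: change_of_variables_mul; last exact: change_of_variables_ushear.
by apply: change_of_variables_diag => //; exact: IH.
Qed.

(** If the corner of G vanishes, adding to the first row a row that meets the
    first column, which is multiplication by an upper shear, creates a
    pivot. *)
Lemma change_of_variablesP n (G : 'M[R]_n) : \det G != 0 ->
  change_of_variables G.
Proof.
elim: n G => [|m IH] G dG.
  move=> f mf f0; rewrite det_mx00 normr1 mul1e /=.
  by rewrite [0 *m G]thinmx0.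
have [i Gi] : exists i, G i 0 != 0.
  apply/existsP; apply: contraNT dG; rewrite negb_exists => /forallP G0.
  rewrite (expand_det_col _ 0) big1// => i _.
  by move: (G0 i); rewrite negbK => /eqP ->; rewrite mul0r.
have [G00|] := eqVneq (G 0 0) 0; last exact: change_of_variables_pivot.
have /unlift_some[k ik _] : 0 != i by apply: contraNneq Gi => <-; rewrite G00.
(* E adds row i = k + 1 of G to its first row, whose corner entry is 0. *)
pose E : 'M[R]_(1 + m) := block_mx 1%:M (delta_mx 0 k) 0 1%:M.
have dE : \det E = 1 by rewrite det_ublock !det1 mulr1.
have cEG : change_of_variables (E *m G).
  apply: change_of_variables_pivot => //; first by rewrite det_mulmx dE mul1r.
  have -> : (E *m G) 0 0 = G 0 0 + G i 0.
    pose G' : 'M[R]_(1 + m) := G.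
    have e0 : 0 = lshift m 0 :> 'I_(1 + m) by exact: val_inj.
    have ei : i = rshift 1 k by rewrite ik; exact: val_inj.
    transitivity ((E *m G') (lshift m 0) (lshift m 0)); first by rewrite -e0.
    rewrite -[G']submxK (@mulmx_block _ 1 m 1 m 1 m) block_mxEul mul1mx -rowE.
    by rewrite !mxE -e0 -ei.
  by rewrite G00 add0r.
move=> f mf f0; rewrite -[RHS]cEG// det_mulmx dE mul1r; congr (_ * _)%E.
have := @change_of_variables_ushear m (delta_mx 0 k) (fun x => f (x *m G))
  (borel_fun_mul (G) mf).
rewrite -/E dE normr1 mul1e => <- //.
by under eq_fun do rewrite -mulmxA.
Qed.

End ChangeOfVariables.

(** * The volume of the standard simplex *)

Section StandardSimplex.
Variable R : realType.
Local Notation mu := (@lebesgue_measure R).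
Local Notation iterated_integral := (@iterated_integral R).

Definition standard_simplex n (s : R) : set 'rV[R]_n :=
  [set y | (forall j, 0 <= y 0 j) /\ \sum_j y 0 j <= s].

Arguments standard_simplex : clear implicits.

Lemma borel_fun_standard_simplex n s :
  borel_fun (fun y : 'rV[R]_n => (\1_(standard_simplex n s) y)%:E).
Proof.
move=> d U y my; apply/measurable_EFinP.
have mle (g : U -> R) (i : interval R) : measurable_fun [set: U] g ->
    measurable [set u | g u \in i].
  move=> mg; rewrite -[X in measurable X]setTI.
  exact: (mg measurableT _ (measurable_itv i)).
rewrite (_ : (fun u => _) = \1_([set u | forall j, 0 <= y u 0 j] `&`
    [set u | \sum_j y u 0 j <= s])); last first.
  apply: funext => u; rewrite !indicE; apply: (congr1 (fun b : bool => b%:R)).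
  by apply/idP/idP; rewrite !inE.
apply: measurable_indic; apply: measurableI.
  rewrite (_ : mkset _ = \bigcap_(j in [set: 'I_n])
      [set u | y u 0 j \in `[0, +oo[]); last first.
    apply/seteqP; split => u /= h; first by move=> j _ /=; rewrite in_itv/= h.
    move=> j; have : y u 0 j \in `[0, +oo[ := h j Logic.I.
    by rewrite in_itv/= andbT.
  by apply: fin_bigcap_measurable => // j _; apply: mle; exact: my.
rewrite (_ : mkset _ = [set u | \sum_j y u 0 j \in `]-oo, s]]); last first.
  by apply/seteqP; split => u /=; rewrite in_itv.
by apply: mle; apply: measurable_sum => j; exact: my.
Qed.

Lemma integral_subr_expr (m : nat) (s : R) : 0 <= s ->
  (\int[mu]_(x in `[0%R, s]) ((s - x) ^+ m / m`!%:R)%:E =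
   (s ^+ m.+1 / m.+1`!%:R)%:E)%E.
Proof.
rewrite le_eqVlt => /predU1P[<-|s0].
  by rewrite set_itv1 integral_set1 expr0n mul0r.
(* An antiderivative, as a polynomial in order to differentiate it formally. *)
pose p : {poly R} := - (m.+1`!%:R^-1)%:P * (s%:P - 'X) ^+ m.+1.
have pE x : p.[x] = - (m.+1`!%:R^-1) * (s - x) ^+ m.+1.
  by rewrite /p !hornerE.
have dpE x : p^`().[x] = (s - x) ^+ m / m`!%:R.
  rewrite /p derivM derivN derivC oppr0 mul0r add0r deriv_exp derivB derivC derivX sub0r.
  rewrite !hornerE factS natrM.
  rewrite hornerMn !hornerE/= -mulr_natr; field.
  by rewrite nat1r !pnatr_eq0 -lt0n fact_gt0.
under eq_integral do rewrite -dpE.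
rewrite (@continuous_FTC2 _ _ (horner p))//.
- rewrite !pE subrr subr0 expr0n/= mulr0 -EFinB sub0r mulNr opprK.
  by rewrite mulrC.
- by apply: continuous_subspaceT => x; exact: continuous_horner.
- split; first by move=> x _; exact: derivable_horner.
  + by apply: cvg_at_right_filter; exact: continuous_horner.
  + by apply: cvg_at_left_filter; exact: continuous_horner.
- by move=> x _; rewrite -derivE.
Qed.

(** The section at x is the standard simplex of one dimension less and size
    s - x, empty for x > s. *)
Lemma volume_standard_simplex n (s : R) : 0 <= s ->
  iterated_integral (fun y : 'rV_n => (\1_(standard_simplex n s) y)%:E) =
  (s ^+ n / n`!%:R)%:E.
Proof.
elim: n s => [|m IH] s s0 /=.
  rewrite indicE mem_set ?expr0 ?divr1//; split; last by rewrite big_ord0.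
  by case.
rewrite -integral_subr_expr// [RHS]integral_mkcond.
apply: eq_integral => x _.
have sE (y : 'rV[R]_m) : standard_simplex m.+1 s (row_mx x%:M y : 'rV_(1 + m)) <->
    0 <= x /\ standard_simplex m (s - x) y.
  have e0 : (row_mx x%:M y : 'rV_(1 + m)) 0 ord0 = x.
    transitivity (row_mx x%:M y 0 (lshift m 0)).
      by congr (fun_of_matrix _ _ _); exact: val_inj.
    by rewrite row_mxEl mxE eqxx mulr1n.
  have eS j : (row_mx x%:M y : 'rV_(1 + m)) 0 (lift ord0 j) = y 0 j.
    transitivity (row_mx x%:M y 0 (rshift 1 j)).
      by congr (fun_of_matrix _ _ _); exact: val_inj.
    by rewrite row_mxEr.
  have eE : \sum_j (row_mx x%:M y : 'rV_(1 + m)) 0 j = x + \sum_j y 0 j.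
    by rewrite big_ord_recl e0; congr (_ + _); apply: eq_bigr => j _.
  rewrite /standard_simplex /= eE lerBrDl; split=> [[h ->]|[x0 [h ->]]].
    by split; [rewrite -e0 | split=> // j; rewrite -eS].
  by split=> // j; case: (unliftP ord0 j) => [k ->|->]; rewrite ?eS ?e0.
rewrite /= patchE; have [|] := boolP (x \in `[0, s]%classic).
  rewrite inE /= in_itv /= => /andP[x0 xs].
  rewrite -IH ?subr_ge0//; congr iterated_integral; apply: funext => y.
  congr (_%:E); rewrite !indicE; apply: (congr1 (fun b : bool => b%:R)).
  by apply/idP/idP; rewrite !inE; [case/sE | move=> ?; apply/sE].
move=> xN; rewrite (_ : (fun y => _) = fun=> 0%E).
  have -> : (fun _ : 'rV[R]_m => 0%E) = fun _ : 'rV[R]_m => (0%:E * (0 : \bar R))%E.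
    by apply: funext => y; rewrite mule0.
  by rewrite iterated_integralZ ?mul0e// => d U y my; exact: measurable_cst.
apply: funext => y; rewrite indicE memNset// => /sE[x0 [y0 ys]].
move/negP: xN; apply; rewrite inE /= in_itv/= x0 -subr_ge0.
by apply: le_trans ys; exact: sumr_ge0.
Qed.

End StandardSimplex.

Arguments standard_simplex {R} n s _.

(** * The weights as the relation between the vertices *)

Section Weights.
Variables (R : realType) (n : nat) (v : 'M[int]_(n.+1, n)).

(** The matrix (1 | v). *)
Definition affine_mx : 'M[int]_n.+1 :=
  \matrix_(i, j) if unlift 0 j is Some k then v i k else 1.

Definition realv : 'M[R]_(n.+1, n) := map_mx intr v.

Lemma vertexE i : vertex R v i = row i realv.
Proof. by rewrite /vertex map_row. Qed.

Lemma sum_vertex (t : 'I_n.+1 -> R) :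
  \sum_i t i *: vertex R v i = (\row_i t i) *m realv.
Proof.
rewrite mulmx_sum_row; apply: eq_bigr => i _.
by rewrite mxE vertexE.
Qed.

Lemma affine_mx0 i : affine_mx i 0 = 1.
Proof. by rewrite mxE unlift_none. Qed.

Lemma affine_mxS i j : affine_mx i (lift 0 j) = v i j.
Proof. by rewrite mxE liftK. Qed.

Lemma adj_affine_mx i : \adj affine_mx 0 i = (-1) ^+ i * \det (row' i v).
Proof.
rewrite mxE /cofactor addn0; congr (_ * \det _).
by apply/matrixP => a b; rewrite !mxE liftK.
Qed.

Lemma abs_adj_affine_mx i : `|\adj affine_mx 0%R i|%N = weight v i.
Proof. by rewrite adj_affine_mx abszMsign. Qed.

(** The first row of the adjugate times the matrix is the determinant times the
    first unit vector.  Against the columns of v this is a relation between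
    the vertices; against the column of ones it gives the sum of its
    coefficients. *)
Lemma adj_affine_mul j :
  \sum_i \adj affine_mx 0 i * affine_mx i j = \det affine_mx *+ (0 == j).
Proof.
by have /matrixP/(_ 0 j) := mul_adj_mx affine_mx; rewrite !mxE.
Qed.

Lemma adj_affine_relation j : \sum_i \adj affine_mx 0 i * v i j = 0.
Proof.
have := adj_affine_mul (lift 0 j); rewrite (negPf (neq_lift _ _)) mulr0n => h.
rewrite -[RHS]h.
by apply: eq_bigr => i _; rewrite affine_mxS.
Qed.

Lemma sum_adj_affine : \sum_i \adj affine_mx 0 i = \det affine_mx.
Proof.
have := adj_affine_mul 0; rewrite eqxx mulr1n => <-.
by apply: eq_bigr => i _; rewrite affine_mx0 mulr1.
Qed.

Hypothesis hv : integral_simplex R v.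

Lemma interior_scale (y : 'rV[R]_n) : exists2 t : R, 0 < t & simplex R v (t *: y).
Proof.
have yc : (fun t : R => t *: y) @ (0 : R)^'+ --> (0 : 'rV[R]_n).
  rewrite -[X in _ --> X](scale0r y).
  by apply: cvg_at_right_filter; exact: scalel_continuous.
have /= near_simplex : \forall t \near (0 : R)^'+, simplex R v (t *: y).
  exact: yc hv.
have [t [t0 st]] : exists t : R, 0 < t /\ simplex R v (t *: y).
  apply: (@filter_ex _ ((0 : R)^'+)); apply: filterI => //.
  exact: nbhs_right_gt.
by exists t.
Qed.

Lemma simplex_positive_span (y : 'rV[R]_n) :
  exists2 t : 'rV[R]_n.+1, forall i, 0 <= t 0 i & y = t *m realv.
Proof.
have [t t0 [s [s0 _ ys]]] := interior_scale y.
exists (t^-1 *: \row_i s i) => [i|]; first by rewrite !mxE mulr_ge0 ?invr_ge0 ?(ltW t0).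
by rewrite -scalemxAl -sum_vertex -ys scalerA mulVf ?gt_eqF// scale1r.
Qed.

(** Adding 1 to the coefficients that express minus the sum of the vertices. *)
Lemma simplex_positive_relation :
  exists2 p : 'rV[R]_n.+1, forall i, 0 < p 0 i & p *m realv = 0.
Proof.
have [t t0 ty] := simplex_positive_span (- (const_mx 1 *m realv)).
exists (t + const_mx 1) => [i|]; first by rewrite !mxE ltr_wpDl.
by rewrite mulmxDl -ty addNr.
Qed.

(** A column w killed by (1 | v) is an affine function vanishing at all
    vertices.  The positive relation shows that its constant term is 0, and
    its linear part vanishes because the vertices span. *)
Lemma det_affine_mx_neq0 : \det affine_mx != 0.
Proof.
rewrite -(intr_eq0 R) -det_map_mx -det_tr; apply/negP => /det0P[w w0].
move=> /(congr1 trmx); rewrite trmx_mul trmxK trmx0 => Mw.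
pose w' : 'cV[R]_n := \col_j w 0 (lift 0 j).
have Mi i : w 0 0 + (row i realv *m w') 0 0 = 0.
  have /colP/(_ i) := Mw; rewrite !mxE big_ord_recl => h; rewrite -[RHS]h.
  congr (_ + _); first by rewrite !mxE unlift_none mul1r.
  by apply: eq_bigr => j _; rewrite !mxE liftK.
have vw : realv *m w' = const_mx (- w 0 0).
  apply/colP => i; have := Mi i; rewrite -row_mul !mxE.
  by move/eqP; rewrite addrC addr_eq0 => /eqP.
have [p p0 pv] := simplex_positive_relation.
have w00 : w 0 0 = 0.
  have /matrixP/(_ 0 0) : p *m realv *m w' = 0 by rewrite pv mul0mx.
  rewrite -mulmxA vw !mxE.
  under eq_bigr do rewrite mxE.
  rewrite -mulr_suml mulrN => /eqP; rewrite oppr_eq0 mulf_eq0 => /orP[|/eqP//].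
  rewrite psumr_eq0 => [/allP/(_ ord0)|i _]; last exact: ltW.
  by rewrite mem_index_enum gt_eqF// => /(_ isT).
have w'0 : w' = 0.
  apply/colP => j.
  have [t _ tE] := simplex_positive_span (delta_mx 0 j).
  have : (delta_mx 0 j : 'rV[R]_n) *m w' = 0.
    have c0 : const_mx 0 = 0 :> 'cV[R]_n.+1 by apply/colP => i; rewrite !mxE.
    by rewrite tE -mulmxA vw w00 oppr0 c0 mulmx0.
  by move/matrixP/(_ 0 0); rewrite -rowE !mxE.
move/eqP: w0; apply; apply/rowP => j; rewrite !mxE.
case: (unliftP 0 j) => [k ->|->//].
by have /colP/(_ k) := w'0; rewrite !mxE.
Qed.

Local Notation D := (\det affine_mx).

(** Up to the factor D, the matrix (1 | v) is inverted by its adjugate, and x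
    is mapped to the sum of its entries times the first unit vector. *)
Lemma kernel_realv (x : 'rV[R]_n.+1) : x *m realv = 0 ->
  forall i, x 0 i * D%:~R = (\sum_j x 0 j) * (\adj affine_mx 0 i)%:~R.
Proof.
move=> xv i; pose MR : 'M[R]_n.+1 := map_mx intr affine_mx.
have xM : x *m MR = (\sum_j x 0 j) *: delta_mx 0 0.
  apply/rowP => j; rewrite !mxE eqxx /=; case: (unliftP 0 j) => [k ->|->].
    rewrite mulr0; have /rowP/(_ k) := xv; rewrite !mxE => h; rewrite -[RHS]h.
    by apply: eq_bigr => l _; rewrite !mxE liftK.
  by rewrite mulr1; apply: eq_bigr => l _; rewrite !mxE unlift_none mulr1.
have := congr1 (fun A => (A *m \adj MR) 0 i) xM.
rewrite -mulmxA mul_mx_adj mul_mx_scalar -scalemxAl -rowE.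
rewrite [LHS]mxE [RHS]mxE [row _ _ _ _]mxE det_map_mx mulrC => ->.
by rewrite /MR -map_mx_adj [X in _ * X]mxE.
Qed.

(** Comparison of the minors with a positive relation, to which they are
    proportional. *)
Lemma adj_affine_sign i : 0 < \adj affine_mx 0 i * D.
Proof.
have [p p0 pv] := simplex_positive_relation.
have s0 : 0 < \sum_j p 0 j.
  by rewrite big_ord_recl ltr_wpDr// sumr_ge0// => j _; exact: ltW.
have := kernel_realv pv i.
have D0 : 0 < D%:~R ^+ 2 :> R by rewrite exprn_even_gt0// intr_eq0 det_affine_mx_neq0.
move=> /(congr1 (fun x => x * D%:~R)); rewrite -mulrA -expr2 -mulrA -intrM => h.
by rewrite -(ltr0z R) -(pmulr_rgt0 _ s0) -h mulr_gt0.
Qed.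

Lemma weight_gt0 i : (0 < weight v i)%N.
Proof.
rewrite -abs_adj_affine_mx absz_gt0; apply/eqP => a0.
by have := adj_affine_sign i; rewrite a0 mul0r.
Qed.

Lemma weightE i : (weight v i)%:Z = Num.sg D * \adj affine_mx 0 i.
Proof.
have := adj_affine_sign i; rewrite -abs_adj_affine_mx abszE.
have [D0|D0|/eqP] := ltgtP D 0; last by rewrite (negPf det_affine_mx_neq0).
  by rewrite nmulr_lgt0// => a0; rewrite ltr0_norm// ltr0_sg// mulN1r.
by rewrite pmulr_lgt0// => a0; rewrite gtr0_norm// gtr0_sg// mul1r.
Qed.

Lemma weight_relation j : \sum_i (weight v i)%:Z * v i j = 0.
Proof.
under eq_bigr do rewrite weightE -mulrA.
by rewrite -mulr_sumr adj_affine_relation mulr0.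
Qed.

Lemma sum_weight : (\sum_i weight v i)%N = `|D|%N.
Proof.
apply/eqP; rewrite -eqz_nat abszE; apply/eqP.
rewrite (big_morph Posz PoszD (erefl _)).
under eq_bigr do rewrite weightE.
rewrite -mulr_sumr sum_adj_affine.
by rewrite normrEsg.
Qed.

Lemma kernel_weight (x : 'rV[R]_n.+1) : x *m realv = 0 ->
  exists k : R, forall i, x 0 i = k * (weight v i)%:R.
Proof.
move=> xv; exists ((\sum_j x 0 j) / D%:~R * (Num.sg D)%:~R) => i.
have D0 : D%:~R != 0 :> R by rewrite intr_eq0 det_affine_mx_neq0.
apply: (mulIf D0); rewrite (kernel_realv xv).
rewrite -[(weight v i)%:R]/((weight v i)%:Z%:~R) weightE intrM.
have s2 : (Num.sg D)%:~R ^+ 2 = 1 :> R.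
  by rewrite -rmorphXn/= sqr_sg det_affine_mx_neq0.
by field: s2.
Qed.

End Weights.

(** * The volume of a lattice simplex *)

Section SimplexVolume.
Variables (R : realType) (n : nat) (v : 'M[int]_(n.+1, n)).
Local Notation D := (\det (affine_mx v)).

(** The rows are the edges issuing from the first vertex. *)
Definition edge_mx : 'M[R]_n :=
  \matrix_(i, j) ((v (lift 0 i) j)%:~R - (v 0 j)%:~R).

(** Subtracting the first row of (1 | v) from the others. *)
Lemma det_edge_mx : \det edge_mx = D%:~R.
Proof.
rewrite -det_map_mx.
pose r : 'rV[R]_n := row 0 (realv R v).
have -> : map_mx intr (affine_mx v) =
    (block_mx 1%:M 0 (const_mx 1) 1%:M : 'M[R]_(1 + n)) *m
     block_mx 1%:M r 0 edge_mx.
  rewrite mulmx_block !(mulmx0, mul0mx, mulmx1, mul1mx, addr0, add0r).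
  have l0 : @lshift 1 n 0 = 0 :> 'I_n.+1 by exact: val_inj.
  have rS k : @rshift 1 n k = lift 0 k :> 'I_n.+1 by exact: val_inj.
  apply/matrixP => i j.
  rewrite -[i](@splitK 1 n (i : 'I_(1 + n))) -[j](@splitK 1 n (j : 'I_(1 + n))).
  case: (@fintype.split 1 n i) => k; case: (@fintype.split 1 n j) => l /=.
  - by rewrite (ord1 k) (ord1 l) [RHS](@block_mxEul R 1 n 1 n) l0 !mxE unlift_none.
  - by rewrite (ord1 k) [RHS](@block_mxEur R 1 n 1 n) l0 rS !mxE liftK.
  - by rewrite (ord1 l) [RHS](@block_mxEdl R 1 n 1 n) l0 rS !mxE unlift_none.
  - rewrite [RHS](@block_mxEdr R 1 n 1 n) !rS !mxE liftK big_ord1 !mxE mul1r.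
    by rewrite addrCA subrr addr0.
by rewrite det_mulmx (@det_lblock R 1 n) (@det_ublock R 1 n) !det1 !mul1r.
Qed.

Hypothesis hv : integral_simplex R v.

Lemma simplex_edgeE (y : 'rV[R]_n) :
  simplex R v (y *m edge_mx + vertex R v 0) <-> standard_simplex n 1 y.
Proof.
have dG : edge_mx \in unitmx.
  by rewrite unitmxE det_edge_mx unitfE intr_eq0 (det_affine_mx_neq0 hv).
have edgeE (t : 'I_n.+1 -> R) : \sum_i t i = 1 ->
    \sum_i t i *: vertex R v i =
    (\row_i t (lift 0 i)) *m edge_mx + vertex R v 0.
  move=> t1; rewrite big_ord_recl /=.
  have -> : t ord0 = 1 - \sum_(i < n) t (lift ord0 i).
    by rewrite -t1 big_ord_recl addrK.
  rewrite scalerBl scale1r -addrA addrC; congr (_ + _).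
  rewrite scaler_suml addrC -sumrB mulmx_sum_row; apply: eq_bigr => i _.
  by rewrite -scalerBr mxE; congr (_ *: _); apply/rowP => j; rewrite !mxE.
split => [[t [t0 t1]]|[y0 y1]].
  rewrite edgeE// => /addIr /(can_inj (mulmxK dG)) ->.
  split => [j|]; first by rewrite mxE.
  under eq_bigr do rewrite mxE.
  by rewrite -t1 [leRHS]big_ord_recl lerDr.
pose t i := if unlift 0 i is Some k then y 0 k else 1 - \sum_j y 0 j.
have tS k : t (lift 0 k) = y 0 k by rewrite /t liftK.
have t1 : \sum_i t i = 1.
  rewrite big_ord_recl {1}/t unlift_none.
  under [X in _ + X]eq_bigr do rewrite tS.
  by rewrite subrK.
exists t; split => // [i|].
  by rewrite /t; case: unliftP => [k _|_]; rewrite ?subr_ge0.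
by rewrite edgeE//; congr (_ *m _ + _); apply/rowP => j; rewrite mxE tS.
Qed.

Lemma simplex_muE : simplex_mu R v = (\sum_i weight v i)%:R.
Proof.
have dG : \det edge_mx != 0.
  by rewrite det_edge_mx intr_eq0 (det_affine_mx_neq0 hv).
have uG : edge_mx \in unitmx by rewrite unitmxE unitfE.
pose f (x : 'rV[R]_n) : \bar R := (\1_(simplex R v) x)%:E.
have f0 x : (0 <= f x)%E by rewrite lee_fin.
pose v0 := vertex R v 0.
have fE y : f (y *m edge_mx + v0) = (\1_(standard_simplex n 1) y)%:E.
  congr (_%:E); rewrite !indicE; apply: (congr1 (fun b : bool => b%:R)).
  by apply/idP/idP; rewrite !inE => /simplex_edgeE.
have mf : borel_fun f.
  have -> : f = fun x => (\1_(standard_simplex n 1)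
      (x *m invmx edge_mx + - v0 *m invmx edge_mx))%:E.
    by apply: funext => x; rewrite -fE -mulmxDl mulmxKV// subrK.
  apply: (borel_fun_affine (f := fun y => (\1_(standard_simplex n 1) y)%:E)).
  exact: borel_fun_standard_simplex.
have mf' : borel_fun (fun x => f (x + v0)).
  by under eq_fun do rewrite -[X in X + _]mulmx1; exact: borel_fun_affine.
rewrite /simplex_mu lebesgue_volumeE -(iterated_integral_shift v0 mf)//.
rewrite -(change_of_variablesP dG mf')//.
under eq_fun do rewrite fE.
rewrite volume_standard_simplex// expr1n -EFinM/=.
rewrite mulrCA mul1r mulfV ?mulr1; last by rewrite pnatr_eq0 -lt0n fact_gt0.
by rewrite det_edge_mx -intr_norm -abszE (sum_weight hv).
Qed.

End SimplexVolume.

(** * The lattice spanned by the vertices of a reduced simplex *)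

Lemma bezout_big_gcdn (I : finType) (w : I -> nat) :
  exists u : I -> int, \sum_i u i * (w i)%:Z = (\big[gcdn/0%N]_i w i)%:Z.
Proof.
pose P (g : nat) := exists u : I -> int, \sum_i u i * (w i)%:Z = g%:Z.
apply: (big_ind P).
- by exists (fun=> 0); rewrite big1// => i _; rewrite mul0r.
- move=> x y [u ux] [u' uy]; have [a [b ab]] := Bezoutz x y.
  exists (fun i => a * u i + b * u' i); rewrite -[RHS]ab -ux -uy !mulr_sumr.
  by rewrite -big_split; apply: eq_bigr => i _; rewrite mulrDl !mulrA.
- move=> i _; exists (fun j => (j == i)%:R).
  rewrite (bigD1 i)//= eqxx mul1r big1 ?addr0// => j /negPf ->.
  by rewrite mul0r.
Qed.

Section Lattice.
Variables (R : realType) (n : nat) (v : 'M[int]_(n.+1, n)).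
Hypothesis (hv : integral_simplex R v) (hred : reduced v).

Lemma reduced_bezout : exists u : 'I_n.+1 -> int, \sum_i u i * (weight v i)%:Z = 1.
Proof.
have [u uE] := bezout_big_gcdn (weight v).
by exists u; rewrite uE [X in Posz X]hred.
Qed.

Lemma mul_row'_lift (i : 'I_n.+1) (x : 'rV[int]_n) :
  exists a : 'rV[int]_n.+1, x *m row' i v = a *m v.
Proof.
exists (\row_j if unlift i j is Some k then x 0 k else 0).
apply/rowP => j; rewrite !mxE (bigD1_ord i)//= !mxE unlift_none mul0r add0r.
by apply: eq_bigr => k _; rewrite !mxE liftK.
Qed.

(** By Cramer's rule applied to all vertices but v_i, the multiple q_i w lies
    in the lattice spanned by the vertices; a Bezout relation between the q_i
    then gives w itself. *)
Lemma vertices_generate (w : 'rV[int]_n) : exists a : 'rV[int]_n.+1, w = a *m v.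
Proof.
have h i : exists a : 'rV[int]_n.+1, (weight v i)%:Z *: w = a *m v.
  have [a aE] := mul_row'_lift i (w *m \adj (row' i v)).
  exists (sgz (\det (row' i v)) *: a); rewrite -scalemxAl -aE.
  rewrite -mulmxA mul_adj_mx mul_mx_scalar scalerA.
  by rewrite -[sgz _]intz -sgrEz -normrEsg -abszE.
pose a i := projT1 (cid (h i)).
have aE i : (weight v i)%:Z *: w = a i *m v by rewrite /a; case: cid.
have [u u1] := reduced_bezout.
exists (\sum_i u i *: a i); rewrite mulmx_suml -[LHS]scale1r -u1 scaler_suml.
by apply: eq_bigr => i _; rewrite -scalerA aE scalemxAl.
Qed.

(** An integral relation is a real multiple k of the weights, and the Bezout
    combination of its entries is k, which is therefore an integer. *)
Lemma kernel_weight_int (a : 'rV[int]_n.+1) : a *m v = 0 ->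
  exists k : int, forall i, a 0 i = k * (weight v i)%:Z.
Proof.
move=> av; have : map_mx intr a *m realv R v = 0.
  by rewrite /realv -map_mxM av map_mx0.
move=> /(kernel_weight hv)[k kE]; have [u u1] := reduced_bezout.
exists (\sum_i u i * a 0 i) => i; apply: (@intr_inj R).
have := kE i; rewrite mxE => ->; rewrite intrM; congr (_ * _).
transitivity (k * (\sum_j u j * (weight v j)%:Z)%:~R); first by rewrite u1 mulr1.
rewrite !rmorph_sum/= mulr_sumr; apply: eq_bigr => j _.
by have := kE j; rewrite mxE !intrM => ->; rewrite mulrCA.
Qed.

Definition lattice_point (a : {ffun 'I_n.+1 -> nat}) : 'rV[int]_n :=
  (\row_i (a i)%:Z) *m v.

(** Two integral families have the same image if and only if they differ by a
    multiple of q, and each class modulo q contains exactly one family of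
    naturals that is not above q. *)
Lemma lattice_point_bij :
  set_bij [set a : {ffun 'I_n.+1 -> nat} | exists i, (a i < weight v i)%N] setT
    lattice_point.
Proof.
split=> //.
- move=> a b /set_mem/= [i ai] /set_mem/= [j bj] ab.
  have [k kE] : exists k : int, forall i, (a i)%:Z - (b i)%:Z = k * (weight v i)%:Z.
    have [|k kE] := @kernel_weight_int ((\row_i (a i)%:Z) - (\row_i (b i)%:Z)).
      by rewrite mulmxBl [X in X - _]ab subrr.
    by exists k => l; have := kE l; rewrite !mxE.
  suff k0 : k = 0.
    apply/ffunP => l; have := kE l; rewrite k0 mul0r => /eqP.
    by rewrite subr_eq0 => /eqP[].
  (* The entry at i forces k <= 0, the entry at j forces k >= 0. *)
  have := kE i; have := kE j; nia.
- move=> w _; have [c ->] := vertices_generate w.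
  pose q i := (weight v i)%:Z.
  have q0 i : 0 < q i by rewrite ltz_nat (weight_gt0 hv).
  have [i _ imin] := @arg_minP _ _ _ (ord0 : 'I_n.+1) xpredT
    (fun i => (c 0%R i %/ q i)%Z) isT.
  (* Subtracting s q makes c nonnegative, with entry at i less than q_i. *)
  pose s := (c 0%R i %/ q i)%Z.
  pose r l := c 0 l - s * q l.
  have r0 l : 0 <= r l.
    rewrite subr_ge0; apply: le_trans (lez_floor _ (lt0r_neq0 (q0 l))).
    by rewrite ler_pM2r//; exact: imin.
  exists [ffun l => absz (r l)] => /=.
    exists i; rewrite ffunE -ltz_nat abszE ger0_norm// /r /s.
    by have := ltz_ceil (c 0 i) (q0 i); rewrite /q; lia.
  rewrite /lattice_point.
  have -> : \row_l ([ffun l => absz (r l)] l)%:Z = c - s *: \row_l q l.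
    by apply/rowP => l; rewrite !mxE ffunE abszE ger0_norm.
  rewrite mulmxBl -scalemxAl (_ : (\row_l q l) *m v = 0) ?scaler0 ?subr0//.
  apply/rowP => j; rewrite !mxE -[RHS](weight_relation hv j).
  by apply: eq_bigr => l _; rewrite mxE.
Qed.

End Lattice.

(** * The Newton function *)

Section NewtonFunction.
Variables (R : realType) (n : nat) (v : 'M[int]_(n.+1, n)).
Hypothesis hv : integral_simplex R v.

(** The difference s - t is a multiple k q, where k <= 0 by the entry at i and
    k >= 0 by the entry at j.  Consequently the sum of the coefficients is
    well defined on the union of the cones over the proper faces. *)
Lemma cone_coord_unique (s t : 'I_n.+1 -> R) i j :
  (forall k, 0 <= s k) -> (forall k, 0 <= t k) -> s i = 0 -> t j = 0 ->
  \sum_k s k *: vertex R v k = \sum_k t k *: vertex R v k -> s =1 t.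
Proof.
move=> s0 t0 si tj; rewrite !sum_vertex => st.
have [|k kE] := kernel_weight hv (x := \row_i s i - \row_i t i).
  by rewrite mulmxBl st subrr.
have {}kE l : s l - t l = k * (weight v l)%:R by have := kE l; rewrite !mxE.
have w0 l : 0 < (weight v l)%:R :> R by rewrite ltr0n (weight_gt0 hv).
suff k0 : k = 0 by move=> l; apply/eqP; rewrite -subr_eq0 kE k0 mul0r.
apply/eqP; rewrite eq_le -(pmulr_lle0 _ (w0 i)) -kE si sub0r oppr_le0 t0/=.
by rewrite -(pmulr_lge0 _ (w0 j)) -kE tj subr0 s0.
Qed.

(** The linear form with value 1 at all vertices but the i-th. *)
Definition height_form (i : 'I_n.+1) (x : 'rV[R]_n) : R :=
  (x *m (invmx (row' i (realv R v)) *m const_mx 1 : 'cV_n)) 0 0.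

Lemma height_form_is_linear i : scalar (height_form i).
Proof.
by move=> a x y; rewrite /height_form mulmxDl -scalemxAl !mxE.
Qed.

HB.instance Definition _ i := GRing.isLinear.Build R 'rV[R]_n R _
  (height_form i) (height_form_is_linear i).

Lemma height_form_vertex i j : i != j -> height_form i (vertex R v j) = 1.
Proof.
move=> /unlift_some[k jk _]; rewrite /height_form vertexE.
have -> : row j (realv R v) = row k (row' i (realv R v)).
  by apply/rowP => l; rewrite !mxE jk.
rewrite -row_mul mulmxA mulmxV ?mul1mx ?mxE//.
rewrite unitmxE unitfE /realv -map_row' det_map_mx intr_eq0 -absz_gt0.
exact: (weight_gt0 hv).
Qed.

Lemma vertex_sum j : vertex R v j = \sum_k (k == j)%:R *: vertex R v k.
Proof.
rewrite (bigD1 j)//= eqxx scale1r big1 ?addr0// => k /negPf ->.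
by rewrite scale0r.
Qed.

Hypothesis hn : (0 < n)%N.

(** The Newton function sends a combination of vertices with nonnegative
    coefficients, one of them 0, to the sum of the coefficients. *)
Lemma is_newton_function_exists : exists nu, is_newton_function v (R := R) nu.
Proof.
pose P x r := exists t : 'I_n.+1 -> R, [/\ forall i, 0 <= t i,
   exists i, t i = 0, x = \sum_i t i *: vertex R v i & r = \sum_i t i].
pose nu x := get (P x).
have nuE t i : (forall i, 0 <= t i) -> t i = 0 ->
    nu (\sum_i t i *: vertex R v i) = \sum_i t i.
  move=> t0 ti; have : P (\sum_i t i *: vertex R v i) (\sum_i t i).
    by exists t; split=> //; exists i.
  move=> /(@getI _ (P _)) [s [s0 [j sj] st nuE]].
  rewrite /nu [LHS]nuE; apply: eq_bigr => k _.
  exact: (cone_coord_unique s0 t0 sj ti).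
exists nu; split=> [j|I /properP[_ [i _ iI]]].
  have [i ij] : exists i : 'I_n.+1, i != j.
    have [->|j0] := eqVneq j ord0; last by exists ord0; rewrite eq_sym.
    by exists ord_max; rewrite -val_eqE/= -lt0n.
  rewrite vertex_sum (nuE _ i); last by rewrite (negPf ij).
    by rewrite (bigD1 j)//= eqxx big1 ?addr0// => k /negPf ->.
  by move=> k; rewrite ler0n.
exists (height_form i) => x /set_mem[t t0 ->].
rewrite big_mkcond/=.
pose s k := if k \in I then t k else 0.
rewrite (eq_bigr (fun k => s k *: vertex R v k)) => [|k _]; last first.
  by rewrite /s; case: ifP; rewrite ?scale0r.
rewrite (nuE _ i) => [|k|]; first last.
- by rewrite /s (negPf iI).
- by rewrite /s; case: ifP.
rewrite linear_sum/=; apply: eq_bigr => k _; rewrite linearZ/=.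
have [<-|ik] := eqVneq i k; first by rewrite /s (negPf iI) mul0r.
by rewrite height_form_vertex// mulr1.
Qed.

(** [newton_function] is an arbitrary function with the defining properties,
    and these determine its values on the cones. *)
Lemma newton_functionE (t : 'I_n.+1 -> R) i : (forall j, 0 <= t j) -> t i = 0 ->
  newton_function R v (\sum_j t j *: vertex R v j) = \sum_j t j.
Proof.
move=> t0 ti.
have [nu nuP] := is_newton_function_exists.
have [nu1 nuL] : is_newton_function v (newton_function R v).
  exact: (@getI _ [set nu | is_newton_function v nu] nu nuP).
have [|L LE] := nuL [set~ i]%SET.
  by apply/properP; split; [exact: subset_predT | exists i; rewrite // !inE eqxx].
have sumE : \sum_j t j *: vertex R v j = \sum_(j in [set~ i]%SET) t j *: vertex R v j.
  rewrite (bigD1 i)//= ti scale0r add0r; apply: eq_bigl => j.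
  by rewrite !inE.
rewrite LE; last by apply/mem_set; exists t.
rewrite linear_sum/=; apply: eq_bigr => j _; rewrite linearZ/=.
have [->|ji] := eqVneq j i; first by rewrite ti mul0r.
rewrite -LE ?nu1 ?mulr1//; apply/mem_set; exists (fun k => (k == j)%:R).
  by move=> k; rewrite ler0n.
rewrite vertex_sum (bigD1 i)//= eq_sym (negPf ji) scale0r add0r.
by apply: eq_bigl => k; rewrite !inE.
Qed.

(** Subtracting k times the relation q from a leaves the point unchanged and
    makes the coefficient at i vanish; here k is the minimum of the
    a_j / q_j. *)
Lemma newton_lattice_point (a : {ffun 'I_n.+1 -> nat}) (k : R) i :
  (forall j, k * (weight v j)%:R <= (a j)%:R) -> (a i)%:R = k * (weight v i)%:R ->
  newton_function R v (map_mx intr (lattice_point v a)) =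
  (\sum_j a j)%:R - k * (\sum_j weight v j)%:R.
Proof.
move=> ka ai; pose t j := (a j)%:R - k * (weight v j)%:R.
have -> : map_mx intr (lattice_point v a) = \sum_j t j *: vertex R v j.
  apply/rowP => l; rewrite sum_vertex !mxE rmorph_sum/=.
  transitivity (\sum_j (a j)%:R * (v j l)%:~R -
                k * \sum_j (weight v j)%:R * (v j l)%:~R : R).
    have -> : \sum_j (weight v j)%:R * (v j l)%:~R = 0 :> R.
      have /(congr1 (fun z : int => z%:~R : R)) := weight_relation hv l.
      by rewrite rmorph_sum/= => h; rewrite -[RHS]h; apply: eq_bigr => j _; rewrite intrM.
    rewrite mulr0 subr0; apply: eq_bigr => j _.
    by rewrite !mxE intrM.
  rewrite mulr_sumr -sumrB; apply: eq_bigr => j _.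
  by rewrite !mxE mulrA -mulrBl.
rewrite (newton_functionE (i := i)).
- by rewrite /t sumrB -mulr_sumr -!natr_sum.
- by move=> j; rewrite subr_ge0.
- by rewrite /t ai subrr.
Qed.

End NewtonFunction.

(** * The staircase of the fractions *)

Lemma count_mem_flatten_nseq (T : eqType) (m : T -> nat) (s : seq T) x :
  uniq s -> count_mem x (flatten [seq nseq (m f) f | f <- s]) = ((x \in s) * m x)%N.
Proof.
elim: s => [//|f s IH] /= /andP[fs us].
rewrite count_cat count_nseq IH// inE /=.
have [->|_] := eqVneq x f; last by rewrite mul0n.
by rewrite (negPf fs) mul0n addn0.
Qed.

Lemma sorted_flatten_nseq disp (T : orderType disp) (m : T -> nat) (s : seq T) :
  sorted <=%O s -> sorted <=%O (flatten [seq nseq (m f) f | f <- s]).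
Proof.
rewrite !le_sorted_pairwise; elim: s => [//|f s IH] /= /andP[fs ps].
rewrite pairwise_cat IH// andbT; apply/andP; split.
  apply/allrelP => x y /nseqP[-> _] /flattenP[_ /mapP[g gs ->] /nseqP[-> _]].
  exact: (allP fs).
by elim: (m f) => [//|k IHk] /=; rewrite IHk andbT; apply/allP => y /nseqP[->].
Qed.

Section FractionChain.
Variables (n : nat) (v : 'M[int]_(n.+1, n)).
Hypothesis wgt0 : forall i, (0 < weight v i)%N.
Implicit Types (i : 'I_n.+1) (p : 'I_n.+1 * nat).

Local Notation q := (weight v).

(** The pair (i, l) stands for the fraction l / q_i; a fraction occurs once for
    each i of which it is a multiple of 1 / q_i. *)
Definition slope p : rat := p.2%:R / (q p.1)%:R.

Definition steps : seq ('I_n.+1 * nat) :=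
  [seq (i, l) | i <- enum 'I_n.+1, l <- iota 0 (q i)].

Definition sorted_steps := sort (relpre slope <=%R) steps.

Lemma mem_steps p : (p \in steps) = (p.2 < q p.1)%N.
Proof.
case: p => i l /=; apply/allpairsPdep/idP => [[j [k [_]]]|lq].
  by rewrite mem_iota add0n => kq [-> ->].
by exists i, l; rewrite mem_enum mem_iota.
Qed.

Lemma uniq_steps : uniq steps.
Proof.
apply: allpairs_uniq_dep => [|i _|]; rewrite ?enum_uniq ?iota_uniq//.
by move=> [i l] [j k] _ _ /= [-> ->].
Qed.

Lemma count_steps (P : pred ('I_n.+1 * nat)) :
  count P steps = (\sum_i count (fun l => P (i, l)) (iota 0 (q i)))%N.
Proof.
rewrite count_flatten -map_comp sumnE big_map big_enum /=.
by apply: eq_bigr => i _; rewrite count_map.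
Qed.

Lemma size_steps : size steps = (\sum_i q i)%N.
Proof.
rewrite -count_predT count_steps; apply: eq_bigr => i _.
by rewrite count_predT size_iota.
Qed.

Lemma mem_sorted_steps p : (p \in sorted_steps) = (p.2 < q p.1)%N.
Proof. by rewrite mem_sort mem_steps. Qed.

Lemma uniq_sorted_steps : uniq sorted_steps.
Proof. by rewrite sort_uniq uniq_steps. Qed.

Lemma size_sorted_steps : size sorted_steps = (\sum_i q i)%N.
Proof. by rewrite size_sort size_steps. Qed.

(** For a fraction x in [0, 1), there is an l < q_i with l / q_i = x if and
    only if q_i x is an integer, and then l is unique. *)
Lemma fraction_mult_count x : x \in fractions v ->
  fraction_mult v x = count_mem x (map slope steps).
Proof.
rewrite mem_sort mem_undup => /allpairsPdep[i0 [l0 [_]]].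
rewrite mem_iota add0n => lq0 xE.
have qr i : 0 < (q i)%:R :> rat by rewrite ltr0n.
have x0 : 0 <= x by rewrite xE divr_ge0 ?ler0n.
have x1 : x < 1 by rewrite xE ltr_pdivrMr// mul1r ltr_nat.
rewrite count_map count_steps /fraction_mult -sum1_card big_mkcond /=.
apply: eq_bigr => i _.
have slopeE l : (slope (i, l) == x) = (l%:R == (q i)%:R * x).
  by rewrite /slope /= -(inj_eq (mulfI (lt0r_neq0 (qr i)))) mulrCA divff ?mulr1// gt_eqF.
rewrite (eq_count slopeE); case: ifP => [/intrP[z zE]|xN]; last first.
  apply/esym/eqP; rewrite -leqn0 leqNgt -has_count; apply/negP => /hasP[l _ /eqP lx].
  by move: xN; rewrite inE -lx rpred_nat.
have z0 : 0 <= z by rewrite -(ler0z rat) -zE mulr_ge0// ltW.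
have zq : (`|z| < q i)%N.
  rewrite -ltz_nat gez0_abs// -(ltr_int rat) -zE.
  by rewrite -[ltRHS]mulr1 ltr_pM2l.
rewrite (@eq_count _ _ (pred1 `|z|%N)) => [|l]; last first.
  rewrite /= zE -[l%:R]/(l%:Z%:~R) (inj_eq (@intr_inj _)) -eqz_nat.
  by rewrite gez0_abs.
by rewrite count_uniq_mem ?iota_uniq// mem_iota /= add0n zq.
Qed.

(** Both sides are sorted and have the same multiplicities. *)
Lemma fraction_seqE : fraction_seq v = map slope sorted_steps.
Proof.
apply: le_sorted_eq.
- by apply: sorted_flatten_nseq; exact: sort_le_sorted.
- by rewrite sorted_map; apply: sort_sorted => x y; exact: le_total.
rewrite perm_sym (perm_trans (y := map slope steps))//.
  by apply: perm_map; rewrite perm_sort.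
apply/allP => x _ /=; rewrite count_mem_flatten_nseq ?sort_uniq ?undup_uniq//.
have [xf|xf] := boolP (x \in fractions v); first by rewrite mul1n fraction_mult_count.
rewrite mul0n; move: xf; rewrite mem_sort mem_undup.
have -> : [seq l%:R / (q i)%:R | i <- enum 'I_n.+1, l <- iota 0 (q i)] = map slope steps.
  by rewrite map_allpairs.
by move/count_memPn ->.
Qed.

Lemma size_fraction_seq : size (fraction_seq v) = (\sum_i q i)%N.
Proof. by rewrite fraction_seqE size_map size_sorted_steps. Qed.

Definition step_index j : 'I_n.+1 := (nth (ord0, 0%N) sorted_steps j).1.

(** The j-th point of the staircase: the number of steps taken in each
    direction among the first j. *)
Definition chain j : {ffun 'I_n.+1 -> nat} :=
  [ffun i => count (fun p => p.1 == i) (take j sorted_steps)].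

Lemma chain0 i : chain 0 i = 0%N.
Proof. by rewrite ffunE take0. Qed.

Lemma chain_last i : chain (\sum_i q i) i = q i.
Proof.
rewrite ffunE -size_sorted_steps take_size.
have /permP -> : perm_eq sorted_steps steps by rewrite perm_sort.
rewrite count_steps (bigD1 i)//= eqxx count_predT size_iota big1 ?addn0//.
by move=> j /negPf ->; rewrite count_pred0.
Qed.

Lemma chainS j i : (j < \sum_i q i)%N ->
  chain j.+1 i = (chain j i + (i == step_index j))%N.
Proof.
rewrite -size_sorted_steps => js.
by rewrite !ffunE (take_nth (ord0, 0%N))// -cats1 count_cat /= addn0 eq_sym.
Qed.

Lemma sum_chain j : (j <= \sum_i q i)%N -> (\sum_i chain j i)%N = j.
Proof.
elim: j => [_|j IH js]; first by rewrite big1// => i _; rewrite chain0.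
under eq_bigr do rewrite chainS//.
rewrite big_split IH 1?ltnW//= (bigD1 (step_index j))//= eqxx big1 ?addn1//.
by move=> i /negPf ->.
Qed.

Lemma slope_sorted j k : (j <= k)%N -> (k < \sum_i q i)%N ->
  (fraction_seq v)`_j <= (fraction_seq v)`_k.
Proof.
move=> jk ks; apply: (sorted_leq_nth le_trans le_refl) => //.
- by rewrite fraction_seqE sorted_map; apply: sort_sorted => x y; exact: le_total.
- by rewrite inE size_fraction_seq (leq_ltn_trans jk).
- by rewrite inE size_fraction_seq.
Qed.

Lemma nth_fraction_seq j : (j < \sum_i q i)%N ->
  (fraction_seq v)`_j = slope (nth (ord0, 0%N) sorted_steps j).
Proof.
by move=> js; rewrite fraction_seqE (nth_map (ord0, 0%N)) ?size_sorted_steps.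
Qed.

(** If b_j(i) < q_i, at least one of the pairs (i, 0), ..., (i, b_j(i)) is not
    among the first j; its slope is at least c_j and at most b_j(i) / q_i. *)
Lemma chain_ge j i : (j < \sum_i q i)%N ->
  (fraction_seq v)`_j * (q i)%:R <= (chain j i)%:R.
Proof.
move=> js; have qr k : 0 < (q k)%:R :> rat by rewrite ltr0n.
have [bq|qb] := ltnP (chain j i) (q i); last first.
  apply: le_trans (_ : (q i)%:R <= _); last by rewrite ler_nat.
  rewrite ler_piMl ?ltW// nth_fraction_seq// /slope ltr_pdivrMr// mul1r ltr_nat.
  by rewrite -mem_sorted_steps mem_nth ?size_sorted_steps.
(* Otherwise b_j(i) + 1 pairs in direction i precede position j. *)
have [l lb lN] : exists2 l, (l <= chain j i)%N & (i, l) \notin take j sorted_steps.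
  apply/not_exists2P => /= h.
  have : (size [seq (i, l) | l <- iota 0 (chain j i).+1] <=
          size [seq p <- take j sorted_steps | p.1 == i])%N.
    apply: uniq_leq_size; first by rewrite map_inj_uniq ?iota_uniq// => x y [].
    move=> _ /mapP[l + ->]; rewrite mem_iota /= add0n ltnS mem_filter eqxx => lb /=.
    by case: (h l) => [/negP//|/negP]; rewrite negbK.
  by rewrite size_map size_iota size_filter ffunE ltnn.
have : (i, l) \in sorted_steps by rewrite mem_sorted_steps (leq_ltn_trans lb).
rewrite -{1}(cat_take_drop j sorted_steps) mem_cat (negPf lN) /=.
move=> /(nthP (ord0, 0%N))[k]; rewrite size_drop nth_drop => kj kE.
have jks : (j + k < \sum_i q i)%N by rewrite -size_sorted_steps -ltn_subRL.
have := slope_sorted (leq_addr k j) jks.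
rewrite [X in _ <= X]nth_fraction_seq// kE /slope /= ler_pdivlMr// => /le_trans; apply.
by rewrite ler_nat.
Qed.

(** The pairs taken before the j-th one (i, l), in its own direction i, all
    have second component less than l.  This bounds b_j(i) by l, and
    [chain_ge] gives the converse bound. *)
Lemma chain_step j : (j < \sum_i q i)%N ->
  (chain j (step_index j))%:R = (fraction_seq v)`_j * (q (step_index j))%:R.
Proof.
move=> js; have qr k : 0 < (q k)%:R :> rat by rewrite ltr0n.
apply/eqP; rewrite eq_le chain_ge// andbT nth_fraction_seq//.
rewrite /slope -/(step_index j) divfK ?gt_eqF// ler_nat.
set i := step_index j; set l := (nth _ _ j).2.
have ilE : nth (ord0, 0%N) sorted_steps j = (i, l) by rewrite [LHS]surjective_pairing.
rewrite ffunE -size_filter.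
rewrite (_ : l = size [seq (i, k) | k <- iota 0 l]); last by rewrite size_map size_iota.
apply: uniq_leq_size; first by rewrite filter_uniq// take_uniq// uniq_sorted_steps.
move=> [i' k]; rewrite mem_filter /= => /andP[/eqP ->].
move=> /(nthP (ord0, 0%N))[m]; rewrite size_take size_sorted_steps js => mj.
rewrite nth_take// => mE; apply/map_f; rewrite mem_iota /= add0n.
have := slope_sorted (ltnW mj) js; rewrite !nth_fraction_seq ?(ltn_trans mj)//.
rewrite mE ilE /slope /= ler_pM2r ?invr_gt0// ler_nat leq_eqVlt => /predU1P[kl|//].
have := mE; rewrite kl -ilE => /eqP.
rewrite nth_uniq ?uniq_sorted_steps ?size_sorted_steps ?(ltn_trans mj)//.
by rewrite ltn_eqF.
Qed.

End FractionChain.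

(** * Formal series and their backward differences *)

Section FiniteSums.

Lemma fsum_finite (I : choiceType) (A : set I) (F : I -> int) : finite_set A ->
  (forall i, ~ A i -> F i = 0) -> \sum_(i \in [set: I]) F i = \sum_(i \in A) F i.
Proof.
move=> fA F0; apply/esym/fsbig_widen => // i [_ Ai]; exact: F0.
Qed.

Lemma fsumD (I : choiceType) (A : set I) (F G : I -> int) : finite_set A ->
  (forall i, ~ A i -> F i = 0) -> (forall i, ~ A i -> G i = 0) ->
  \sum_(i \in [set: I]) (F i + G i) =
  \sum_(i \in [set: I]) F i + \sum_(i \in [set: I]) G i.
Proof.
move=> fA F0 G0; rewrite !(fsum_finite fA)//; first exact: fsbig_split.
by move=> i Ai; rewrite F0// G0// addr0.
Qed.

Lemma exchange_fsum_ord (I : choiceType) (A : set I) m (F : I -> 'I_m -> int) :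
  finite_set A -> (forall i, ~ A i -> F i =1 fun=> 0) ->
  \sum_(i \in [set: I]) \sum_(j < m) F i j = \sum_(j < m) \sum_(i \in [set: I]) F i j.
Proof.
move=> fA F0; rewrite (fsum_finite fA) => [|i Ai]; last first.
  by rewrite big1// => j _; exact: F0.
rewrite fsbig_finite// exchange_big; apply: eq_bigr => j _.
rewrite (fsum_finite fA) ?fsbig_finite// => i Ai; exact: F0.
Qed.

End FiniteSums.

Section Series.
Variable R : realType.
Implicit Types (s t : fseries R) (e : R).

(** Multiplication by 1 - z on coefficient functions. *)
Definition backward_diff s : fseries R := fun e => s e - s (e - 1).

Lemma fs_mul_monomial0 s : fs_mul (fs_monomial 0) s = s.
Proof.
apply: funext => e; rewrite /fs_mul (fsum_finite (finite_set1 0)) => [|a a0].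
  by rewrite fsbig_set1 /fs_monomial eqxx mul1r subr0.
by rewrite /fs_monomial; case: eqP a0 => // _ _; rewrite mul0r.
Qed.

Lemma fs_mul_binomial s : fs_mul (fs_monomial 0 \- fs_monomial 1) s = backward_diff s.
Proof.
apply: funext => e; rewrite /fs_mul (@fsum_finite _ [set 0; 1]); last first.
- move=> a /= a01; rewrite /fs_monomial /=.
  case: eqP a01 => [-> []|_]; first by left.
  by case: eqP => [-> []|_ _]; [right | rewrite subrr mul0r].
- exact: finite_set2.
rewrite fsbigU0//=; last 1 first.
- by move=> x [/= -> /eqP]; rewrite eq_sym oner_eq0.
rewrite !fsbig_set1 /fs_monomial /backward_diff !eqxx eq_sym oner_eq0 subr0.
by rewrite subr0 mul1r sub0r mulN1r.
Qed.

Definition finite_supp s := finite_set [set e | s e != 0].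

Lemma finite_supp_shift s : finite_supp s -> finite_supp (fun e => s (e - 1)).
Proof.
move=> fs; rewrite /finite_supp.
rewrite (_ : mkset _ = (fun e => e + 1) @` [set e | s e != 0]).
  exact: finite_image.
apply/seteqP; split => e /=; first by exists (e - 1); rewrite // subrK.
by move=> [e' h <-]; rewrite addrK.
Qed.

Lemma finite_supp_backward_diff s : finite_supp s -> finite_supp (backward_diff s).
Proof.
move=> fs; apply: sub_finite_set (_ : finite_set
    ([set e | s e != 0] `|` [set e | s (e - 1) != 0])); last first.
  by rewrite finite_setU; split=> //; exact: finite_supp_shift.
move=> e /=; rewrite /backward_diff.
by have [->|?] := eqVneq (s e) 0; [rewrite sub0r oppr_eq0; right | left].
Qed.

Lemma fs_mul_backward_diff s t : finite_supp s ->
  fs_mul (backward_diff s) t = backward_diff (fs_mul s t).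
Proof.
move=> fs; apply: funext => e; rewrite /fs_mul /backward_diff.
have -> : \sum_(a \in [set: R]) s a * t (e - 1 - a) =
          \sum_(a \in [set: R]) s (a - 1) * t (e - a).
  rewrite (reindex_fsbigT (fun a : R => a - 1)); last first.
    by exists (fun a => a + 1) => a; rewrite ?subrK ?addrK.
  by apply: eq_fsbigr => a _; congr (_ * t _); rewrite opprB addrA subrK.
rewrite -[X in _ = _ + X]mulN1r mulr_fsumr.
rewrite -(@fsumD _ ([set e | s e != 0] `|` [set e | s (e - 1) != 0])).
- by apply: eq_fsbigr => a _; rewrite mulrBl mulN1r.
- by rewrite finite_setU; split=> //; exact: finite_supp_shift.
- move=> a /= /not_orP[/negP]; rewrite negbK => /eqP -> _.
  by rewrite mul0r.
- move=> a /= /not_orP[_ /negP]; rewrite negbK => /eqP ->.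
  by rewrite mul0r mulr0.
Qed.

(** [fs_exp] multiplies from the left, so that the backward differences fall
    on the first factor; since that factor has finite support they can be
    moved to the product. *)
Lemma fs_mul_binomial_exp n s :
  fs_mul (fs_exp (fs_monomial 0 \- fs_monomial 1) n) s = iter n backward_diff s.
Proof.
have fE m : fs_exp (fs_monomial 0 \- fs_monomial 1) m =
    iter m backward_diff (fs_monomial 0) :> fseries R.
  by rewrite /fs_exp; elim: m => [//|m IH]; rewrite !iterS IH fs_mul_binomial.
rewrite fE.
suff [] : finite_supp (iter n backward_diff (fs_monomial 0)) /\
    fs_mul (iter n backward_diff (fs_monomial 0)) s = iter n backward_diff s by [].
elim: n => [|n [fn IH]] /=.
  rewrite fs_mul_monomial0; split=> //.
  apply: sub_finite_set (finite_set1 0) => e /=; rewrite /fs_monomial.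
  by case: (eqVneq e 0) => // _; rewrite mulr0n eqxx.
by split; [exact: finite_supp_backward_diff | rewrite fs_mul_backward_diff// IH].
Qed.

End Series.

(** * Counting finite families of naturals by their sum *)

Section Compositions.
Variables (R : realType) (I : finType).
Implicit Types (a b : {ffun I -> nat}) (A : {set I}).

Definition supported A a := [forall i, (i \notin A) ==> (a i == 0)%N].

Definition total a := (\sum_i a i)%N.

(** The series 1 / (1 - z)^#|A|.  It is indexed by the families on I supported
    in A, so that removing an element of A needs no change of type. *)
Definition count_total A : fseries R := fun e =>
  \sum_(a \in [set: {ffun I -> nat}]) ((supported A a && ((total a)%:R == e))%:R : int).

Lemma finite_total e : finite_set [set a : {ffun I -> nat} | (total a)%:R == e :> R].
Proof.
have [[m <-]|N] := pselect (exists m : nat, m%:R = e); last first.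
  rewrite (_ : mkset _ = set0)//; apply/seteqP; split=> // a /= /eqP ae.
  by case: N; exists (total a).
apply: sub_finite_set (_ : finite_set
  ((fun f : {ffun I -> 'I_m.+1} => [ffun i => nat_of_ord (f i)]) @` setT)); last first.
  by apply: finite_image; exact: finite_finset.
move=> a /=; rewrite eqr_nat => /eqP am; exists [ffun i => inord (a i)] => //.
apply/ffunP => i; rewrite !ffunE inordK// ltnS -am /total.
by rewrite (bigD1 i)//= leq_addr.
Qed.

(** The families with a positive entry at i are those of sum one less, with a
    unit added at i. *)
Lemma backward_diff_count_total A i : i \in A ->
  backward_diff (count_total A) = count_total (A :\ i).
Proof.
move=> iA; apply: funext => e; rewrite /backward_diff /count_total.
pose F a := (supported A a && (0 < a i)%N && ((total a)%:R == e))%:R : int.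
apply/eqP; rewrite subr_eq; apply/eqP.
have -> : \sum_(a \in [set: {ffun I -> nat}])
    ((supported A a && ((total a)%:R == e - 1))%:R : int) = \sum_(a \in setT) F a.
  pose h a : {ffun I -> nat} := [ffun k => (a k + (k == i))%N].
  rewrite -[RHS](@fsbig_widen _ _ _ _
    [set a : {ffun I -> nat} | (0 < a i)%N])//; last first.
    by move=> a [_ /= /negP/negPf ai]; rewrite /F ai andbF.
  rewrite [RHS](reindex_fsbig h setT).
    apply: eq_fsbigr => a _; rewrite /F; congr ((_ && _)%:R : int).
      have -> : (0 < h a i)%N by rewrite ffunE eqxx addn1.
      rewrite andbT; apply: eq_forallb => k; rewrite ffunE.
      by case: (eqVneq k i) => [->|_]; rewrite ?iA// addn0.
    rewrite -(inj_eq (addIr 1)) subrK natr1; congr (_%:R == _).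
    rewrite /total; under [RHS]eq_bigr do rewrite ffunE.
    have e1 : (\sum_k (k == i))%N = 1%N.
      by rewrite (bigD1 i)//= eqxx big1// => k /negPf ->.
    by rewrite big_split/= e1 addn1.
  split=> [a _|a b _ _ /ffunP ab|a /= ai]; first by rewrite /= ffunE eqxx addn1.
    by apply/ffunP => k; have := ab k; rewrite !ffunE => /addIn.
  exists [ffun k => (a k - (k == i))%N] => //.
  apply/ffunP => k; rewrite !ffunE; case: (eqVneq k i) => [->|_]; first by rewrite subnK.
  by rewrite subn0 addn0.
rewrite -(fsumD (finite_total e)).
- apply: eq_fsbigr => a _; rewrite /F.
  case: eqP => _; last by rewrite !andbF addr0.
  rewrite !andbT.
  have -> : supported (A :\ i) a = supported A a && (a i == 0)%N.
    apply/forallP/andP => [h|[/forallP h ai] k].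
      split; last by have := h i; rewrite !inE eqxx.
      apply/forallP => k; apply/implyP => kA; have := h k.
      by rewrite !inE (negPf kA) andbF.
    by have := h k; rewrite !inE; case: (eqVneq k i) => [->|].
  by rewrite lt0n; case: (supported A a); case: (a i == 0)%N.
- by move=> a /negP/negPf /= ->; rewrite andbF.
- by move=> a /negP/negPf /= h; rewrite /F h andbF.
Qed.

Lemma count_total0 : count_total finset.set0 = fs_monomial 0.
Proof.
apply: funext => e; rewrite /count_total.
pose z : {ffun I -> nat} := [ffun=> 0%N].
rewrite (fsum_finite (finite_set1 z)) => [|a az].
  rewrite fsbig_set1 /fs_monomial eq_sym; congr ((_ : bool)%:R).
  have -> : supported finset.set0 z by apply/forallP => i; rewrite ffunE eqxx implybT.
  by rewrite /total big1// => i _; rewrite ffunE.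
case: (boolP (supported finset.set0 a)) => // /forallP h; case: az.
by apply/ffunP => i; have := h i; rewrite ffunE inE => /eqP.
Qed.

Lemma iter_backward_diff_count_total A :
  iter #|A| (@backward_diff R) (count_total A) = fs_monomial 0.
Proof.
have [m] := ubnP #|A|; elim: m A => // m IH A; rewrite ltnS => Am.
have [->|[i iA]] := set_0Vmem A; first by rewrite cards0; exact: count_total0.
rewrite (cardsD1 i) iA iterSr (backward_diff_count_total iA) IH//.
by move: Am; rewrite (cardsD1 i) iA.
Qed.

End Compositions.

(** * The Newton spectrum *)

Section Spectrum.
Variables (R : realType) (n : nat) (v : 'M[int]_(n.+1, n)).
Hypotheses (hn : (0 < n)%N) (hv : integral_simplex R v) (hred : reduced v).
Local Notation M := (\sum_i weight v i)%N.
Local Notation c := (fraction_seq v).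
Implicit Types a : {ffun 'I_n.+1 -> nat}.

Let wgt0 := weight_gt0 hv.

Definition above_chain j a := [forall i, (chain v j i <= a i)%N].

(** The families above the j-th point of the staircase that are not above the
    next one. *)
Definition step_cone j a :=
  above_chain j a && (a (step_index v j) == chain v j (step_index v j)).

Lemma step_coneE j a : (j < M)%N ->
  (step_cone j a)%:R = (above_chain j a)%:R - (above_chain j.+1 a)%:R :> int.
Proof.
move=> jM; set i := step_index v j.
(* The next point differs only at i, by one unit. *)
have -> : above_chain j.+1 a = above_chain j a && (chain v j i < a i)%N.
  apply/forallP/andP => [h|[/forallP h ia] k].
    split; last by have := h i; rewrite chainS// eqxx addn1.
    apply/forallP => k; apply: leq_trans (h k).
    by rewrite chainS// leq_addr.
  by rewrite chainS//; case: (eqVneq k i) => [->|_]; rewrite ?addn1 ?addn0.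
rewrite /step_cone -/i; have [/forallP h|_] := boolP (above_chain j a); last by [].
by rewrite /= eq_sym; have := h i; rewrite leq_eqVlt; case: ltngtP.
Qed.

(** The sum telescopes from b_0 = 0 to b_M = q. *)
Lemma sum_step_cone a :
  \sum_(j < M) (step_cone j a)%:R = [exists i, (a i < weight v i)%N]%:R :> int.
Proof.
rewrite (eq_bigr (fun j : 'I_M => - ((above_chain j.+1 a)%:R - (above_chain j a)%:R))).
  rewrite sumrN -(big_mkord xpredT
    (fun j => (above_chain j.+1 a)%:R - (above_chain j a)%:R)).
  rewrite telescope_sumr// opprB.
  have -> : above_chain 0 a by apply/forallP => i; rewrite chain0.
  have -> : above_chain M a = ~~ [exists i, (a i < weight v i)%N].
    rewrite negb_exists; apply: eq_forallb => i.
    by rewrite chain_last// -leqNgt.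
  by case: [exists i, _].
by move=> j _; rewrite step_coneE// opprB.
Qed.

Lemma newton_step_cone j a : (j < M)%N -> step_cone j a ->
  newton_function R v (map_mx intr (lattice_point v a)) =
  (total a)%:R - M%:R * ratr c`_j.
Proof.
move=> jM /andP[/forallP ja /eqP ai].
rewrite (newton_lattice_point hv hn (k := ratr c`_j) (i := step_index v j)).
- by rewrite mulrC.
- move=> i; apply: le_trans (_ : (chain v j i)%:R <= _); last by rewrite ler_nat.
  have := chain_ge wgt0 i jM; rewrite -(ler_rat R) rmorphM/= !ratr_nat.
  exact.
- rewrite ai; have := congr1 (fun x : rat => ratr x : R) (chain_step wgt0 jM).
  by rewrite rmorphM/= !ratr_nat.
Qed.

(** Translating by b_j, whose entries have sum j. *)
Lemma count_step_cone j e : (j < M)%N ->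
  \sum_(a \in [set: {ffun 'I_n.+1 -> nat}])
    ((step_cone j a && ((total a)%:R - M%:R * ratr c`_j == e :> R))%:R : int) =
  count_total (~: [set step_index v j]) (e - (j%:R - M%:R * ratr c`_j)).
Proof.
move=> jM; pose h a : {ffun 'I_n.+1 -> nat} := [ffun i => (chain v j i + a i)%N].
rewrite -(@fsbig_widen _ _ _ _ [set a | above_chain j a])//; last first.
  by move=> a [_ /= /negP/negPf ja]; rewrite /step_cone ja.
rewrite (reindex_fsbig h setT).
  apply: eq_fsbigr => a _; congr ((_ && _)%:R : int).
    rewrite /step_cone (_ : above_chain j (h a)) /=; last first.
      by apply/forallP => i; rewrite [leqRHS]ffunE leq_addr.
    rewrite [h a _]ffunE -{2}[chain v j _]addn0 eqn_add2l.
    apply/idP/forallP => [a0 i|/(_ (step_index v j))]; last by rewrite !inE eqxx.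
    by rewrite !inE negbK; apply/implyP => /eqP ->.
  have -> : total (h a) = (j + total a)%N.
    rewrite /total; under eq_bigr do rewrite ffunE.
    by rewrite big_split/= sum_chain// ltnW.
  rewrite natrD; apply/eqP/eqP => [<-|->]; ring.
split=> [a _|a b _ _ /ffunP ab|a /= /forallP ja].
- by apply/forallP => i; rewrite [leqRHS]ffunE leq_addr.
- by apply/ffunP => k; have := ab k; rewrite !ffunE => /addnI.
- exists [ffun k => (a k - chain v j k)%N] => //.
  by apply/ffunP => k; rewrite [LHS]ffunE [X in (_ + X)%N]ffunE subnKC.
Qed.

Lemma lattice_series :
  (fun e => \sum_(w \in [set: 'rV[int]_n])
              fs_monomial (newton_function R v (map_mx intr w)) e) =
  (fun e => \sum_(j < M) count_total (~: [set step_index v j])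
              (e - (j%:R - M%:R * ratr c`_j))).
Proof.
apply: funext => e.
rewrite (reindex_fsbig (lattice_point v)
  [set a | exists i, (a i < weight v i)%N]) /=; last exact: (lattice_point_bij hv hred).
pose G (a : {ffun 'I_n.+1 -> nat}) : int :=
  \sum_(j < M) (step_cone j a && ((total a)%:R - M%:R * ratr c`_j == e))%:R.
have GE a : G a = [exists i, (a i < weight v i)%N]%:R *
    fs_monomial (newton_function R v (map_mx intr (lattice_point v a))) e.
  rewrite -sum_step_cone mulr_suml; apply: eq_bigr => j _.
  have [ja|_] := boolP (step_cone j a); last by rewrite mul0r.
  by rewrite (newton_step_cone _ ja)// mul1r /fs_monomial eq_sym.
transitivity (\sum_(a \in [set: {ffun 'I_n.+1 -> nat}]) G a).
  rewrite fsbig_mkcond; apply: eq_fsbigr => a _; rewrite GE /patch.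
  case: (boolP [exists i, _]) => [/existsP h|h]; first by rewrite mem_set// mul1r.
  rewrite memNset ?mul0r// => -[i ai]; move/existsP: h; apply; by exists i.
rewrite (exchange_fsum_ord (A := \bigcup_(j in [set: 'I_M])
    [set a | (total a)%:R == e + M%:R * ratr c`_j])).
- by apply: eq_bigr => j _; exact: count_step_cone.
- by apply: bigcup_finite => [|j _]; [exact: finite_finset | exact: finite_total].
- move=> a aN j; case: eqP => [ae|_]; last by rewrite andbF.
  by case: aN; exists j => //=; rewrite -ae subrK.
Qed.

Lemma iter_backward_diff_sum m k (s : 'I_m -> fseries R) (x : 'I_m -> R) :
  iter k (@backward_diff R) (fun e => \sum_(j < m) s j (e - x j)) =
  (fun e => \sum_(j < m) iter k (@backward_diff R) (s j) (e - x j)).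
Proof.
elim: k => [//|k IH]; rewrite iterS IH; apply: funext => e.
rewrite /backward_diff -sumrB; apply: eq_bigr => j _.
by rewrite iterS /backward_diff addrAC.
Qed.

(** In each of the M pieces, n backward differences cancel the n free
    coordinates. *)
Lemma newton_spectrumE :
  newton_spectrum R v =
  (fun e : R => \sum_(j < M) fs_monomial (j%:R - M%:R * ratr c`_j) e).
Proof.
rewrite /newton_spectrum fs_mul_binomial_exp lattice_series.
rewrite (iter_backward_diff_sum n
  (fun j : 'I_M => count_total (~: [set step_index v j]%SET))
  (fun j : 'I_M => j%:R - M%:R * ratr c`_j)).
apply: funext => e; apply: eq_bigr => j _.
have nE : n = #|~: [set step_index v j]%SET| by rewrite cardsC1 card_ord.
rewrite [X in iter X]nE iter_backward_diff_count_total.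
by rewrite /fs_monomial subr_eq0.
Qed.

End Spectrum.

Theorem theorem3p3 (R : realType) (n : nat) (v : 'M[int]_(n.+1, n))
  (hn : (0 < n)%N) (hv : integral_simplex R v) (hred : reduced v) :
  simplex_mu R v = (size (fraction_seq v))%:R /\
  newton_spectrum R v =
    (fun e : R => \sum_(j < size (fraction_seq v)) fs_monomial (alpha R v j) e).
Proof.
rewrite /alpha simplex_muE// (size_fraction_seq (weight_gt0 hv)).
by split=> //; exact: newton_spectrumE.
Qed.
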